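(* Let $p\ge1$ be a fixed integer. Given a minimum-knapsack set $K=\{x\in\{0,1\}^n : \sum_{j=1}^n w_jx_j\ge w_0\}$ with $w_j\in\mathbb{Z}_+$ for $0\le j\le n$, and $0<\epsilon<1$, there is an algorithm that, with input $x^*\in[0,1]^n$, either finds an inequality valid for $K$ with coefficients in $\{0,1,\ldots,p\}$ that is violated by $x^*$, or shows that $x^*$ satisfies all such valid inequalities within additive error $\epsilon$ (that is, $\alpha^Tx^*\ge\alpha_0-\epsilon$ for every inequality $\alpha^Tx\ge\alpha_0$ valid for $K$ with coefficients in $\{0,1,\ldots,p\}$). The complexity of the algorithm is polynomial in $n$ and $1/\epsilon$.
   Context: $\mathbb{Z}_+$ denotes the nonnegative integers. Without loss of generality $w_j\le w_0$ for $1\le j\le n$. An inequality $\alpha^Tx\ge\alpha_0$ is valid for $K$ if every $x\in K$ satisfies it; it is violated by $x^*$ if $\alpha^Tx^*<\alpha_0$. ''Coefficients in $\{0,1,\ldots,p\}$'' means $\alpha_j\in\{0,1,\ldots,p\}$ for all $0\le j\le n$, i.e. the right-hand side $\alpha_0$ is included. *)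

(* Defs.v *)
From mathcomp Require Import all_boot all_order all_algebra.
From mathcomp Require Import reals.
Set Implicit Arguments.
Unset Strict Implicit.
Unset Printing Implicit Defensive.
Import Order.TTheory GRing.Theory Num.Theory.
Local Open Scope ring_scope.

(** * Minimum-knapsack sets and their inequalities *)

(* [w j] and [a j] are the weight and coefficient of item j+1; the right-hand
   sides [w0] and [a0] are kept apart. *)

Definition min_knapsack n (w0 : nat) (w : 'I_n -> nat) : {set {ffun 'I_n -> bool}} :=
  [set x : {ffun 'I_n -> bool} | (w0 <= \sum_(j < n) w j * x j)%N].

Definition valid n (K : {set {ffun 'I_n -> bool}}) (a0 : nat) (a : 'I_n -> nat) : Prop :=
  forall x : {ffun 'I_n -> bool}, x \in K -> (a0 <= \sum_(j < n) a j * x j)%N.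

Definition coefs_upto n (p a0 : nat) (a : 'I_n -> nat) : Prop :=
  (a0 <= p)%N /\ forall j, (a j <= p)%N.

Definition lhs (R : realType) n (a : 'I_n -> nat) (x : 'I_n -> R) : R :=
  \sum_(j < n) (a j)%:R * x j.

(** * Algorithms: a random access machine with an integer and a real memory *)

(* Both memories consist of arrays [a[0], a[1], ...] named by natural numbers,
   and programs are structured (assignment, branching, while).  The arithmetic
   operations are addition, subtraction and comparison, at unit cost.
   Multiplication is left out on purpose: the bit size of the numbers (for
   rationals, over a common denominator) then grows by at most about one per
   operation, so no computing power is hidden in huge
   numbers, and on rational inputs a polynomial number of steps is also
   polynomial time in the bit model. *)

Inductive iexp : Type :=
  | ICst of nat
  | IGet of nat & iexp
  | IAdd of iexp & iexp
  | ISub of iexp & iexp.     (* truncated at 0 *)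

Inductive rexp : Type :=
  | RCst of nat
  | RGet of nat & iexp
  | RAdd of rexp & rexp
  | RSub of rexp & rexp.

Inductive bexp : Type :=
  | BILe of iexp & iexp
  | BRLe of rexp & rexp
  | BNot of bexp
  | BAnd of bexp & bexp.

Inductive cmd : Type :=
  | Skip
  | ISet of nat & iexp & iexp   (* ISet a i e :  a[i] := e *)
  | RSet of nat & iexp & rexp
  | Seq of cmd & cmd
  | If of bexp & cmd & cmd
  | While of bexp & cmd.

Record state (R : realType) := State {
  imem : nat -> nat -> nat;
  rmem : nat -> nat -> R }.

Definition upd T (m : nat -> nat -> T) (a i : nat) (v : T) : nat -> nat -> T :=
  fun b j => if (b == a) && (j == i) then v else m b j.

Fixpoint ieval (R : realType) (s : state R) (e : iexp) : nat :=
  match e with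
  | ICst k => k
  | IGet a i => imem s a (ieval s i)
  | IAdd e1 e2 => (ieval s e1 + ieval s e2)%N
  | ISub e1 e2 => (ieval s e1 - ieval s e2)%N
  end.

Fixpoint reval (R : realType) (s : state R) (e : rexp) : R :=
  match e with
  | RCst k => k%:R
  | RGet a i => rmem s a (ieval s i)
  | RAdd e1 e2 => reval s e1 + reval s e2
  | RSub e1 e2 => reval s e1 - reval s e2
  end.

Fixpoint beval (R : realType) (s : state R) (b : bexp) : bool :=
  match b with
  | BILe e1 e2 => (ieval s e1 <= ieval s e2)%N
  | BRLe e1 e2 => reval s e1 <= reval s e2
  | BNot b1 => ~~ beval s b1
  | BAnd b1 b2 => beval s b1 && beval s b2
  end.

Fixpoint icost (e : iexp) : nat :=
  match e with
  | ICst _ => 1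
  | IGet _ i => (icost i).+1
  | IAdd e1 e2 | ISub e1 e2 => (icost e1 + icost e2).+1
  end.

Fixpoint rcost (e : rexp) : nat :=
  match e with
  | RCst _ => 1
  | RGet _ i => (icost i).+1
  | RAdd e1 e2 | RSub e1 e2 => (rcost e1 + rcost e2).+1
  end.

Fixpoint bcost (b : bexp) : nat :=
  match b with
  | BILe e1 e2 => (icost e1 + icost e2).+1
  | BRLe e1 e2 => (rcost e1 + rcost e2).+1
  | BNot b1 => (bcost b1).+1
  | BAnd b1 b2 => (bcost b1 + bcost b2).+1
  end.

(* [exec c s t s']: started in state s, the program c halts after t elementary
   operations in state s'. *)
Inductive exec (R : realType) : cmd -> state R -> nat -> state R -> Prop :=
  | exec_skip s : exec Skip s 1 s
  | exec_iset a i e s :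
      exec (ISet a i e) s (icost i + icost e).+1
        (State (upd (imem s) a (ieval s i) (ieval s e)) (rmem s))
  | exec_rset a i e s :
      exec (RSet a i e) s (icost i + rcost e).+1
        (State (imem s) (upd (rmem s) a (ieval s i) (reval s e)))
  | exec_seq c1 c2 s t1 s1 t2 s2 :
      exec c1 s t1 s1 -> exec c2 s1 t2 s2 -> exec (Seq c1 c2) s (t1 + t2)%N s2
  | exec_if b c1 c2 s t s' :
      exec (if beval s b then c1 else c2) s t s' ->
      exec (If b c1 c2) s (bcost b + t).+1 s'
  | exec_while_false b c s :
      ~~ beval s b -> exec (While b c) s (bcost b).+1 s
  | exec_while_true b c s t1 s1 t2 s2 :
      beval s b -> exec c s t1 s1 -> exec (While b c) s1 t2 s2 ->
      exec (While b c) s (bcost b + t1 + t2).+1 s2.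

Lemma exec_det (R : realType) c (s : state R) t1 s1 t2 s2 :
  exec c s t1 s1 -> exec c s t2 s2 -> t1 = t2 /\ s1 = s2.
Proof.
move=> H; elim: H t2 s2 => {c s t1 s1} [||||||b c s t1 s1 t2 s2 Hb _ IH1 _ IH2].
- by move=> s t s' H; inversion H.
- by move=> a i e s t s' H; inversion H.
- by move=> a i e s t s' H; inversion H.
- move=> c1 c2 s t1 s1 t2 s2 _ IH1 _ IH2 t s' H; inversion H as
    [| | |? ? ? ? u1 ? u2 H1 H2| | |]; subst.
  by case: (IH1 _ _ H1) => ? ?; subst; case: (IH2 _ _ H2) => ? ?; subst.
- move=> b c1 c2 s t s' _ IH t2 s2 H; inversion H as
    [| | | |? ? ? ? ? ? H1| |]; subst.
  by case: (IH _ _ H1) => ? ?; subst.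
- move=> b c s Hb t s' H; inversion H as
    [| | | | | |? ? ? ? ? ? ? H1]; subst => //.
  by rewrite H1 in Hb.
- move=> t s' H; inversion H as
    [| | | | |? ? ? H0|? ? ? ? ? ? ? H0 H1 H2]; subst.
    by rewrite Hb in H0.
  by case: (IH1 _ _ H1) => ? ?; subst; case: (IH2 _ _ H2) => ? ?; subst.
Qed.

(** * Input and output *)

(* Integer array 0 is [n], integer array 1 is [w_0, w_1, ..., w_n]; real array
   0 is [eps], real array 1 is [0, x_1, ..., x_n]; all other cells are 0. *)
Definition input (R : realType) n (w0 : nat) (w : 'I_n -> nat) (eps : R)
    (x : 'I_n -> R) : state R :=
  State
    (fun a i => match a, i with
                | 0%N, 0%N => n
                | 1%N, 0%N => w0
                | 1%N, i'.+1 => oapp w 0%N (insub i')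
                | _, _ => 0%N
                end)
    (fun a i => match a, i with
                | 0%N, 0%N => eps
                | 1%N, i'.+1 => oapp x 0 (insub i')
                | _, _ => 0
                end).

(* Integer array 2 is the verdict (1: violated inequality found, 0: none beyond
   eps); integer array 3 is the inequality [a_0, a_1, ..., a_n]. *)
Definition verdict (R : realType) (s : state R) : nat := imem s 2 0.
Definition out_rhs (R : realType) (s : state R) : nat := imem s 3 0.
Definition out_coef (R : realType) n (s : state R) : 'I_n -> nat :=
  fun j => imem s 3 j.+1.

Definition separates (R : realType) n (p w0 : nat) (w : 'I_n -> nat) (eps : R)
    (x : 'I_n -> R) (s : state R) : Prop :=
  let K := min_knapsack w0 w in
  (verdict s = 1%N /\
     let a0 := out_rhs s in let a := out_coef s in
     [/\ coefs_upto p a0 a, valid K a0 a & lhs a x < a0%:R])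
  \/
  (verdict s = 0%N /\
     forall (a0 : nat) (a : 'I_n -> nat),
       coefs_upto p a0 a -> valid K a0 a -> a0%:R - eps <= lhs a x).

(* Main.v *)
Require Import Defs.
From mathcomp Require Import all_boot all_order all_algebra.
From mathcomp Require Import reals.
From mathcomp Require Import zify ring lra.
Set Implicit Arguments.
Unset Strict Implicit.
Unset Printing Implicit Defensive.
Import Order.TTheory GRing.Theory Num.Theory.
Local Open Scope ring_scope.

(** Split the items into classes by their coefficient k in {1,...,p}.  Since
    a0 <= p, a 0-1 point violating the inequality contains fewer than p items of each
    class, so only the p heaviest items of each class matter for validity: another
    item, if no heavier than these, may enter the class without destroying
    validity.  The algorithm guesses these p items for each class (n^(p^2)
    guesses).  An item gets either coefficient 0, or the cheapest coefficient that
    the guess permits; it remains to keep the weight of the items with coefficient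
    0 small (i.e. to cover much weight) at small cost.  This is a knapsack problem,
    solved by dynamic programming after rounding n p x_j / eps down to an integer,
    which costs at most eps overall.  Every candidate so obtained is tested for
    violation and, by a second knapsack with capacity below p, for validity, so a
    wrong guess does no harm. *)

(** * Cost-bounded program logic *)

Section Logic.
Variable R : realType.
Implicit Types (c : cmd) (s : state R) (Q : state R -> Prop).

(** Total correctness with a time bound: halting within [T] is part of the claim. Execution is
    deterministic, so the run that exists is the only one. *)
Definition wp (T : nat) c s Q : Prop :=
  exists t s', [/\ exec c s t s', (t <= T)%N & Q s'].

Definition iset s a i v : state R := State (upd (imem s) a i v) (rmem s).
Definition rset s a i v : state R := State (imem s) (upd (rmem s) a i v).

(* Arrays written by a program; all others are framed by [exec_same]. *)
Fixpoint iwr c : seq nat :=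
  match c with
  | ISet a _ _ => [:: a]
  | Seq c1 c2 | If _ c1 c2 => iwr c1 ++ iwr c2
  | While _ c1 => iwr c1
  | _ => [::]
  end.

Fixpoint rwr c : seq nat :=
  match c with
  | RSet a _ _ => [:: a]
  | Seq c1 c2 | If _ c1 c2 => rwr c1 ++ rwr c2
  | While _ c1 => rwr c1
  | _ => [::]
  end.

(* Meant for programs without loops: [While] counts 0. *)
Fixpoint ub c : nat :=
  match c with
  | Skip => 1
  | ISet _ i e => (icost i + icost e).+1
  | RSet _ i e => (icost i + rcost e).+1
  | Seq c1 c2 => ub c1 + ub c2
  | If b c1 c2 => (bcost b + maxn (ub c1) (ub c2)).+1
  | While _ _ => 0
  end.

Definition same (l rl : seq nat) s s' : Prop :=
  (forall a, a \notin l -> imem s' a =1 imem s a) /\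
  (forall a, a \notin rl -> rmem s' a =1 rmem s a).

Lemma same_refl l rl s : same l rl s s.
Proof. by split. Qed.

Lemma same_sub l rl l' rl' s s' :
  {subset l <= l'} -> {subset rl <= rl'} -> same l rl s s' -> same l' rl' s s'.
Proof.
move=> sub rsub [H1 H2]; split=> a Ha.
  by apply: H1; apply: contra Ha; apply: sub.
by apply: H2; apply: contra Ha; apply: rsub.
Qed.

Lemma same_in l rl l' rl' s s' :
  all (mem l) l' -> all (mem rl) rl' -> same l' rl' s s' -> same l rl s s'.
Proof. by move=> /allP H1 /allP H2; apply: same_sub. Qed.

Lemma same_trans l rl s1 s2 s3 :
  same l rl s1 s2 -> same l rl s2 s3 -> same l rl s1 s3.
Proof.
move=> [H1 H2] [H3 H4]; split=> a Ha i; first by rewrite H3 // H1.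
by rewrite H4 // H2.
Qed.

Lemma same_iset l rl s a i v : a \in l -> same l rl s (iset s a i v).
Proof.
move=> al; split=> // b bl j /=; rewrite /upd.
by case: eqP bl => //= ->; rewrite al.
Qed.

Lemma same_rset l rl s a i v : a \in rl -> same l rl s (rset s a i v).
Proof.
move=> al; split=> // b bl j /=; rewrite /upd.
by case: eqP bl => //= ->; rewrite al.
Qed.

Lemma exec_same c s t s' : exec c s t s' -> same (iwr c) (rwr c) s s'.
Proof.
elim=> {c s t s'} //=.
- by move=> a i e s; apply: same_iset; rewrite inE.
- by move=> a i e s; apply: same_rset; rewrite inE.
- move=> c1 c2 s t1 s1 t2 s2 _ H1 _ H2.
  by apply: same_trans (same_sub _ _ H1) (same_sub _ _ H2) => a;
    rewrite mem_cat => ->; rewrite ?orbT.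
- move=> b c1 c2 s t s' _ H; apply: same_sub H => a.
    by rewrite mem_cat; case: ifP => _ ->; rewrite ?orbT.
  by rewrite mem_cat; case: ifP => _ ->; rewrite ?orbT.
- by move=> b c s t1 s1 t2 s2 _ _ H1 _ H2; apply: same_trans H1 H2.
Qed.

(** Consequence rule that also supplies the frame: the arrays written are read off the syntax of
    [c]. *)
Lemma wp_mono T T' c s Q Q' :
  wp T c s Q -> (T <= T')%N ->
  (forall s', same (iwr c) (rwr c) s s' -> Q s' -> Q' s') -> wp T' c s Q'.
Proof.
move=> [t [s' [H1 H2 H3]]] TT' QQ'; exists t, s'; split=> //.
  exact: leq_trans TT'.
by apply: QQ' => //; apply: exec_same H1.
Qed.

Lemma wp_le T T' c s Q : wp T' c s Q -> (T' <= T)%N -> wp T c s Q.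
Proof. by move=> H L; apply: wp_mono H L _. Qed.

Lemma wp_skip s Q : Q s -> wp 1 Skip s Q.
Proof. by move=> H; exists 1%N, s; split=> //; constructor. Qed.

Lemma wp_iset a i e s Q :
  Q (iset s a (ieval s i) (ieval s e)) -> wp (icost i + icost e).+1 (ISet a i e) s Q.
Proof. by move=> H; do 2 eexists; split; [constructor| |exact: H]. Qed.

Lemma wp_rset a i e s Q :
  Q (rset s a (ieval s i) (reval s e)) -> wp (icost i + rcost e).+1 (RSet a i e) s Q.
Proof. by move=> H; do 2 eexists; split; [constructor| |exact: H]. Qed.

Lemma wp_seq T1 T2 c1 c2 s Q :
  wp T1 c1 s (fun s1 => wp T2 c2 s1 Q) -> wp (T1 + T2) (Seq c1 c2) s Q.
Proof.
move=> [t1 [s1 [H1 L1 [t2 [s2 [H2 L2 HQ]]]]]].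
exists (t1 + t2)%N, s2; split=> //; first exact: exec_seq H1 H2.
exact: leq_add.
Qed.

Lemma wp_if T1 T2 b c1 c2 s Q :
  (beval s b -> wp T1 c1 s Q) -> (~~ beval s b -> wp T2 c2 s Q) ->
  wp (bcost b + maxn T1 T2).+1 (If b c1 c2) s Q.
Proof.
move=> H1 H2; case Eb: (beval s b); [have := H1 Eb | have := H2 (negbT Eb)];
  case=> t [s' [H L HQ]]; exists (bcost b + t).+1, s'; split=> //.
- by apply: exec_if; rewrite Eb.
- by rewrite ltnS leq_add2l leq_max L.
- by apply: exec_if; rewrite Eb.
- by rewrite ltnS leq_add2l leq_max L orbT.
Qed.

(** The index of [I] bounds the number of iterations still to come; the last summand pays for the
    final failing test. *)
Lemma wp_while T N b c s Q (I : nat -> state R -> Prop) :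
  I N s ->
  (forall k s', I k s' -> beval s' b ->
     (0 < k)%N /\ wp T c s' (I k.-1)) ->
  (forall k s', I k s' -> ~~ beval s' b -> Q s') ->
  wp (N * (bcost b + T).+1 + (bcost b).+1) (While b c) s Q.
Proof.
move=> HI Hb HQ; elim: N s HI => [|N IH] s HI; case Eb: (beval s b).
- by have [] := Hb _ _ HI Eb.
- exists (bcost b).+1, s; split=> //; first by apply: exec_while_false; rewrite Eb.
  by apply: HQ HI _; rewrite Eb.
- have [_ [t1 [s1 [H1 L1 HI1]]]] := Hb _ _ HI Eb.
  have [t2 [s2 [H2 L2 H3]]] := IH _ HI1.
  exists (bcost b + t1 + t2).+1, s2; split=> //; first exact: exec_while_true H1 H2.
  by rewrite mulSn -addnA; set z := (N * _ + _)%N in L2 *; lia.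
- exists (bcost b).+1, s; split; first by apply: exec_while_false; rewrite Eb.
    by rewrite leq_addl.
  by apply: HQ HI _; rewrite Eb.
Qed.

(** * Counting loops and unrolled loops *)

Definition For a k b c : cmd :=
  Seq (ISet a (ICst k) (ICst 0))
    (While (BNot (BILe b (IGet a (ICst k))))
       (Seq c (ISet a (ICst k) (IAdd (IGet a (ICst k)) (ICst 1))))).

Definition Tfor (B N T : nat) : nat := (N * (T + (B + 11)) + (B + 8))%N.

(** The body may write other cells of the array [a] that holds the counter, so preservation of cell
    [k] is a proof obligation. The nested guess loops, whose counters share one array, need this
    generality. *)
Lemma wp_for a k b c N Nm T s Q (I : nat -> state R -> Prop) :
  (forall s', same (a :: iwr c) (rwr c) s s' -> ieval s' b = N) ->
  (N <= Nm)%N ->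
  I 0%N (iset s a k 0) ->
  (forall i s', (i < N)%N -> same (a :: iwr c) (rwr c) s s' ->
     imem s' a k = i -> I i s' ->
     wp T c s' (fun s2 => imem s2 a k = i /\ I i.+1 (iset s2 a k i.+1))) ->
  (forall s', same (a :: iwr c) (rwr c) s s' -> I N s' -> Q s') ->
  wp (Tfor (icost b) Nm T) (For a k b c) s Q.
Proof.
move=> Hb NNm H0 HI HQ.
have LT : (3 + (N * (bcost (BNot (BILe b (IGet a (ICst k)))) + (T + 6)).+1
             + (bcost (BNot (BILe b (IGet a (ICst k))))).+1)
          <= Tfor (icost b) Nm T)%N.
  rewrite /Tfor /=.
  have -> : ((icost b + 2).+2 + (T + 6)).+1 = (T + (icost b + 11))%N by lia.
  by have := leq_mul NNm (leqnn (T + (icost b + 11))); lia.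
apply: wp_mono LT (fun _ _ H => H).
apply: wp_seq; apply: wp_iset => /=.
pose J m s' := [/\ (m <= N)%N, same (a :: iwr c) (rwr c) s s',
  imem s' a k = (N - m)%N & I (N - m)%N s'].
apply: (@wp_while _ N _ _ _ _ J).
- split=> //; last by rewrite subnn.
    by apply: same_iset; rewrite inE eqxx.
  by rewrite /= /upd !eqxx subnn.
- move=> m s' [mN S V HIm] /=; rewrite Hb // V -ltnNge => lt.
  split; first by move: lt; lia.
  have -> : (T + 6)%N = (T + (icost (ICst k) + icost (IAdd (IGet a (ICst k)) (ICst 1))).+1)%N.
    by [].
  apply: wp_seq; apply: wp_mono (HI _ _ lt S V HIm) (leqnn _) _ => s2 S2 [V2 I2].
  have E : ((N - m).+1 = N - m.-1)%N by move: lt; lia.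
  have m0 : (m.-1 <= N)%N by move: lt; lia.
  apply: wp_iset => /=; rewrite V2 addn1; split=> //.
  + apply: same_trans S _; apply: same_trans (_ : same _ _ s' s2) _.
      by apply: same_sub S2 => // x xc; rewrite inE xc orbT.
    by apply: same_iset; rewrite inE eqxx.
  + by rewrite /= /upd !eqxx.
  + by rewrite -E.
- move=> m s' [mN S V HIm] /=; rewrite Hb // V negbK => le.
  have E : (N - m = N)%N by move: le; lia.
  by apply: HQ => //; rewrite -E.
Qed.

Lemma wp_for_frame a k b c N Nm T s Q (I : nat -> state R -> Prop) :
  a \notin iwr c ->
  (forall s', same (a :: iwr c) (rwr c) s s' -> ieval s' b = N) ->
  (N <= Nm)%N ->
  I 0%N (iset s a k 0) ->
  (forall i s', (i < N)%N -> same (a :: iwr c) (rwr c) s s' ->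
     imem s' a k = i -> I i s' ->
     wp T c s' (fun s2 => I i.+1 (iset s2 a k i.+1))) ->
  (forall s', same (a :: iwr c) (rwr c) s s' -> I N s' -> Q s') ->
  wp (Tfor (icost b) Nm T) (For a k b c) s Q.
Proof.
move=> ac Hb NNm H0 HI HQ; apply: wp_for (HQ) => // i s' iN S V Ii.
apply: wp_mono (HI _ _ iN S V Ii) (leqnn _) _ => s2 [S2 _] I2; split=> //.
by rewrite S2.
Qed.

(** The index is a constant of the program text and runs down from [m.-1] to 0, so later assignments
    belong to smaller indices. *)
Fixpoint unroll m (body : nat -> cmd) : cmd :=
  if m is m'.+1 then Seq (body m') (unroll m' body) else Skip.

Lemma wp_unroll m body T s Q (I : nat -> state R -> Prop) :
  I m s ->
  (forall i s', (i < m)%N -> I i.+1 s' -> wp T (body i) s' (I i)) ->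
  (forall s', I 0%N s' -> Q s') ->
  wp (m * T).+1 (unroll m body) s Q.
Proof.
elim: m s => [|m IH] s /= Im HI HQ; first by apply: wp_skip; apply: HQ.
rewrite mulSn -addnS; apply: wp_seq.
apply: wp_mono (HI _ _ (leqnn _) Im) (leqnn _) _ => s' _ Im'.
by apply: IH => // i s2 im; apply: HI; apply: ltnW.
Qed.

Lemma all_unroll P m body :
  (forall i, all P (iwr (body i))) -> all P (iwr (unroll m body)).
Proof. by move=> H; elim: m => //= m IH; rewrite all_cat H. Qed.

Lemma all_runroll P m body :
  (forall i, all P (rwr (body i))) -> all P (rwr (unroll m body)).
Proof. by move=> H; elim: m => //= m IH; rewrite all_cat H. Qed.

(** Explicit lists [l] and [rl] replace the computed ones, which do not reduce to concrete lists
    when the body contains an [unroll] over the variable [p]. *)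
Lemma wp_for_in l rl a k b c N Nm T s Q (I : nat -> state R -> Prop) :
  a \notin l -> all (mem l) (iwr c) -> all (mem rl) (rwr c) ->
  (forall s', same (a :: l) rl s s' -> ieval s' b = N) ->
  (N <= Nm)%N ->
  I 0%N (iset s a k 0) ->
  (forall i s', (i < N)%N -> same (a :: l) rl s s' ->
     imem s' a k = i -> I i s' ->
     wp T c s' (fun s2 => same l rl s' s2 -> I i.+1 (iset s2 a k i.+1))) ->
  (forall s', same (a :: l) rl s s' -> I N s' -> Q s') ->
  wp (Tfor (icost b) Nm T) (For a k b c) s Q.
Proof.
move=> al cl crl Hb NNm H0 HI HQ.
have sub s1 s2 : same (a :: iwr c) (rwr c) s1 s2 -> same (a :: l) rl s1 s2.
  apply: same_in => //=; rewrite inE eqxx /=; apply: sub_all cl => y; rewrite /= inE.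
  by move=> yl; apply/orP; right.
apply: (wp_for_frame (N := N) (I := I)) => //.
- by apply/negP => /(allP cl); apply/negP.
- by move=> s' S; apply: Hb; apply: sub.
- move=> i s' iN S V Ii; apply: wp_mono (HI _ _ iN (sub _ _ S) V Ii) (leqnn _) _.
  by move=> s2 S2; apply; apply: same_in S2.
by move=> s' S; apply: HQ; apply: sub.
Qed.

End Logic.

(** * Exchange and rounding *)

Lemma subset_of_card (T : finType) (A : {set T}) k :
  (k <= #|A|)%N -> exists2 B : {set T}, B \subset A & #|B| = k.
Proof.
move=> kA; exists [set x in take k (enum A)].
  by apply/subsetP => x; rewrite inE => /mem_take; rewrite mem_enum.
rewrite cardsE (card_uniqP _) ?take_uniq ?enum_uniq //.
by rewrite size_takel // -cardE.
Qed.

Lemma exchange_set (T : finType) (S X : {set T}) (w : T -> nat) (t : nat) :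
  (forall j, j \in X -> j \in S \/ (w j <= t)%N) ->
  (forall j, j \in S -> (t <= w j)%N) ->
  (t = 0%N \/ #|X| <= #|S|)%N ->
  exists Y : {set T}, [/\ Y \subset S, (#|Y| <= #|X|)%N &
    (\sum_(j in X) w j <= \sum_(j in Y) w j)%N].
Proof.
move=> XS St tX.
have wXS : (\sum_(j in X :\: S) w j <= #|X :\: S| * t)%N.
  rewrite -sum_nat_const; apply: leq_sum => j; rewrite inE => /andP[jS jX].
  by case: (XS j jX) => //; rewrite (negPf jS).
case: tX wXS => [->|cXS]; rewrite ?muln0 => wXS.
  exists (X :&: S); split; first exact: subsetIr.
    by rewrite subset_leq_card // subsetIl.
  by rewrite (big_setID S) /=; move: wXS; rewrite leqn0 => /eqP ->; rewrite addn0.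
have [Z ZS cZ] : exists2 Z : {set T}, Z \subset S :\: X & #|Z| = #|X :\: S|.
  by apply: subset_of_card; have := cardsID S X; have := cardsID X S; rewrite setIC; lia.
have dXZ : [disjoint X :&: S & Z].
  rewrite disjoint_sym; apply: disjointWl ZS _.
  by rewrite disjoint_subset; apply/subsetP => j; rewrite !inE => /andP[/negPf ->].
exists ((X :&: S) :|: Z); split.
- by rewrite subUset subsetIr (subset_trans ZS) // subsetDl.
- by rewrite cardsU (_ : X :&: S :&: Z = set0) ?cards0 ?subn0 ?cZ ?cardsID //;
    apply/eqP; rewrite setI_eq0.
rewrite [leqRHS](eq_bigl [predU X :&: S & Z]); last by move=> j; rewrite !inE.
rewrite bigU //= (big_setID S) /= leq_add2l (leq_trans wXS) // -cZ -sum_nat_const.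
apply: leq_sum => j /(subsetP ZS); rewrite inE => /andP[_]; exact: St.
Qed.

Lemma sum_by_class (I : finType) (p : nat) (a F : I -> nat) :
  (forall j, a j <= p)%N ->
  (\sum_j F j = \sum_(j | a j == 0) F j + \sum_(k < p) \sum_(j | a j == k.+1) F j)%N.
Proof.
move=> ap; rewrite (partition_big (fun j => inord (a j) : 'I_p.+1) xpredT) //=.
rewrite big_ord_recl; congr (_ + _)%N.
  by apply: eq_bigl => j /=; rewrite -val_eqE /= inordK ?ltnS.
apply: eq_bigr => k _; apply: eq_bigl => j /=.
by rewrite -val_eqE /= inordK ?ltnS.
Qed.

Section Exchange.
Variables (n p w0 : nat) (w a a' : 'I_n -> nat) (a0 : nat).
Variables (S : 'I_p -> {set 'I_n}) (t : 'I_p -> nat).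

(** Let [x] in the knapsack set violate [a']. In each positive class its items are traded, by
    [exchange_set], for at most as many items with the same coefficient in [a], and all items of
    coefficient 0 in [a] are added. The new point is no lighter and costs no more, against the
    validity of [a]. *)
Lemma exchange_valid :
  valid (min_knapsack w0 w) a0 a -> coefs_upto p a0 a -> (forall j, a' j <= p)%N ->
  (forall (k : 'I_p) j, j \in S k -> a j = k.+1) ->
  (forall (k : 'I_p) j, j \in S k -> t k <= w j)%N ->
  (forall k, t k = 0%N \/ #|S k| = p) ->
  (forall (k : 'I_p) j, a' j = k.+1 -> j \in S k \/ w j <= t k)%N ->
  (\sum_(j | a' j == 0) w j <= \sum_(j | a j == 0) w j)%N ->
  valid (min_knapsack w0 w) a0 a'.
Proof.
move=> va [a0p ap] a'p Sa St tS a'S w00 x; rewrite inE => wx.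
rewrite leqNgt; apply/negP => ax.
pose X (k : 'I_p) := [set j | x j & a' j == k.+1].
have sumX (F : 'I_n -> nat) (k : 'I_p) :
    (\sum_(j | a' j == k.+1) F j * x j = \sum_(j in X k) F j)%N.
  rewrite [RHS](eq_bigl (fun j => (a' j == k.+1) && x j)); last first.
    by move=> j; rewrite inE andbC.
  by rewrite big_mkcondr /=; apply: eq_bigr => j _; case: (x j); rewrite ?muln1 ?muln0.
have a'x : (\sum_(j < n) a' j * x j = \sum_(k < p) k.+1 * #|X k|)%N.
  rewrite (sum_by_class _ a'p) big1 ?add0n; last by move=> j /eqP ->.
  apply: eq_bigr => k _; rewrite sumX mulnC -sum_nat_const; apply: eq_bigr => j.
  by rewrite inE => /andP[_ /eqP].
(* Class [k] alone costs at least [#|X k|], and the whole cost is below [a0 <= p]. So a full [S k]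
   is large enough for the trade. *)
have Xp k : (#|X k| <= p)%N.
  apply: leq_trans a0p; apply: leq_trans (ltnW ax).
  by rewrite a'x (bigD1 k) //= mulSn -addnA leq_addr.
have /fin_all_exists[Y HY] : forall k, exists Y : {set 'I_n},
    [/\ Y \subset S k, (#|Y| <= #|X k|)%N &
      (\sum_(j in X k) w j <= \sum_(j in Y) w j)%N].
  move=> k; apply: (@exchange_set _ _ _ _ (t k)) => //.
  - by move=> j; rewrite inE => /andP[_ /eqP]; apply: a'S.
  - exact: St.
  - by case: (tS k) => ->; [left|right].
have Ya k j : j \in Y k -> a j = k.+1.
  by have [/subsetP YS _ _] := HY k => /YS; apply: Sa.
pose x' := [ffun j => (a j == 0)%N || [exists k, j \in Y k]].
have sumY (F : 'I_n -> nat) (k : 'I_p) :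
    (\sum_(j | a j == k.+1) F j * x' j = \sum_(j in Y k) F j)%N.
  rewrite [RHS](eq_bigl (fun j => (a j == k.+1) && x' j)).
    by rewrite big_mkcondr /=; apply: eq_bigr => j _; case: (x' j); rewrite ?muln1 ?muln0.
  move=> j; rewrite ffunE; apply/idP/andP => [jY|[/eqP aj /orP[]]].
  - by rewrite (Ya _ _ jY) eqxx; split=> //=; apply/existsP; exists k.
  - by rewrite aj.
  - case/existsP => k' jY; have := Ya _ _ jY; rewrite aj => -[kk].
    by rewrite (_ : k = k') //; apply: val_inj.
(* The cost of [x'] under [a] is at most that of [x] under [a'], which is below [a0]. *)
suff : (a0 <= \sum_(j < n) a j * x' j)%N.
  rewrite leqNgt => /negP; apply; apply: leq_ltn_trans ax.
  rewrite a'x (sum_by_class _ ap) big1 ?add0n; last by move=> j /eqP ->.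
  apply: leq_sum => k _; rewrite sumY.
  rewrite (eq_bigr (fun=> k.+1)); last by move=> j; apply: Ya.
  by rewrite sum_nat_const mulnC leq_mul2l; have [_ ->] := HY k; rewrite orbT.
apply: va; rewrite inE; apply: leq_trans wx _.
rewrite (sum_by_class _ a'p) [leqRHS](sum_by_class _ ap); apply: leq_add.
  apply: (@leq_trans (\sum_(j | a' j == 0) w j)%N).
    by apply: leq_sum => j _; case: (x j); rewrite ?muln1 ?muln0.
  apply: leq_trans w00 _; apply: leq_sum => j /eqP aj.
  by rewrite ffunE aj muln1.
by apply: leq_sum => k _; rewrite sumX sumY; have [] := HY k.
Qed.

End Exchange.

(** Rounding down loses at most [eps / (p * n)] per unit of coefficient, and the coefficients of
    [a'] add up to at most [p * n]. For [a], rounding down errs in the favourable direction. *)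
Lemma rounded_cost (R : realType) (n p : nat) (a a' u : 'I_n -> nat) (x : 'I_n -> R)
    (eps b : R) :
  0 < eps -> (0 < p)%N -> (forall j, a' j <= p)%N ->
  (forall j, (u j)%:R * eps <= (p * n)%:R * x j < (u j).+1%:R * eps) ->
  (\sum_(j < n) a' j * u j <= \sum_(j < n) a j * u j)%N ->
  lhs a x < b - eps -> lhs a' x < b.
Proof.
move=> eps0 p0 a'p ux a'a ab.
suff : lhs a' x <= lhs a x + eps by lra.
case: n => [|n] in a a' u x a'p ux a'a ab *.
  by rewrite /lhs !big_ord0; lra.
have N0 : 0 < (p * n.+1)%:R :> R by rewrite ltr0n muln_gt0 p0.
rewrite -(ler_pM2l N0).
have H1 : (p * n.+1)%:R * lhs a' x <= \sum_(j < n.+1) (a' j * u j + p)%:R * eps.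
  rewrite /lhs mulr_sumr; apply: ler_sum => j _.
  rewrite mulrCA; apply: (@le_trans _ _ ((a' j)%:R * ((u j).+1%:R * eps))).
    by rewrite ler_wpM2l // ltW //; case/andP: (ux j).
  rewrite mulrA -natrM ler_wpM2r ?(ltW eps0) // ler_nat mulnS addnC leq_add2l; exact: a'p.
apply: le_trans H1 _.
rewrite -mulr_suml -natr_sum big_split /= sum_nat_const card_ord.
have H2 : (\sum_(j < n.+1) a j * u j)%:R * eps <= (p * n.+1)%:R * lhs a x.
  rewrite /lhs mulr_sumr natr_sum mulr_suml; apply: ler_sum => j _.
  by rewrite natrM -mulrA [leRHS]mulrCA ler_wpM2l //; case/andP: (ux j).
rewrite mulrDr natrD mulrDl [(n.+1 * p)%N]mulnC lerD2r.
by apply: le_trans H2; rewrite ler_wpM2r ?(ltW eps0) // ler_nat.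
Qed.

(** * Guesses, knapsack optima and completeness of the search *)

Definition ksum m (A : nat -> bool) (f : nat -> nat) : nat :=
  (\sum_(j < m) A j * f j)%N.

Definition opt m (val cost : nat -> nat) v (A : nat -> bool) : Prop :=
  (ksum m A cost <= v)%N /\
  forall B, (ksum m B cost <= v -> ksum m B val <= ksum m A val)%N.

(* [g] lists guessed items, [p] per class; [n] stands for no item. *)
Definition allowed (W : nat -> nat) p (g : nat -> nat) k j : bool :=
  (W j <= W (g (k * p + p.-1)))%N || has (fun i => j == g (k * p + i)%N) (iota 0 p).

(* [c] is the least [k.+1 > i] such that class [k] is allowed for [j], or 0. *)
Definition least_class W p g i j c : Prop :=
  (forall k, (i <= k < p)%N -> allowed W p g k j -> (0 < c <= k.+1)%N) /\
  ((0 < c)%N -> (c <= p)%N /\ allowed W p g c.-1 j).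

(** An item with offer 0 keeps coefficient 0 even when selected, so its weight does not count as
    covered. *)
Definition kval (W c : nat -> nat) j : nat := if c j == 0%N then 0%N else W j.
Definition kcost (u c : nat -> nat) j : nat := (c j * u j)%N.

(** What a fruitless search under the guess [g] establishes. One optimal set per capacity [v] is
    enough, and the right-hand side 0 is left out because a nonnegative point cannot violate it. *)
Definition refuted (R : realType) n p w0 (w : 'I_n -> nat) (x : 'I_n -> R) (W u : nat -> nat)
    (g : nat -> nat) : Prop :=
  exists c : nat -> nat,
    (forall j, (j < n)%N -> least_class W p g 0 j (c j)) /\
    forall v, (v <= \sum_(j < n) p * u j)%N ->
      exists A, opt n (kval W c) (kcost u c) v A /\
        forall a0, (a0 < p)%N ->
          valid (min_knapsack w0 w) a0.+1 (fun j : 'I_n => (A j * c j)%N) ->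
          a0.+1%:R <= lhs (fun j : 'I_n => (A j * c j)%N) x.

Section TopItems.
Variables (n p : nat) (w a : 'I_n -> nat) (W : nat -> nat).
Hypotheses (p0 : (0 < p)%N) (Ww : forall j : 'I_n, W j = w j) (Wn : W n = 0%N).

(** [l] holds the [p] heaviest items of coefficient [k] in descending order, so [t] is the weight of
    the last one. In a class of fewer than [p] items, [l] is the whole class and [nth] falls back on
    [n], which weighs 0. *)
Lemma top_items k : exists l : seq 'I_n,
  let t := W (nth n (map val l) p.-1) in
  [/\ uniq l, (size l <= p)%N,
      (forall j, j \in l -> a j = k /\ (t <= w j)%N),
      t = 0%N \/ size l = p &
      forall j, a j = k -> j \in l \/ (w j <= t)%N].
Proof.
pose r (i j : 'I_n) := (w j <= w i)%N.
have rtr : transitive r by move=> y x z /= xy yz; apply: leq_trans yz xy.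
pose s := sort r (enum [pred j | a j == k]).
have srt : sorted r s by apply: sort_sorted => i j; apply: leq_total.
have ms j : (j \in s) = (a j == k) by rewrite mem_sort mem_enum.
exists (take p s) => t.
have sz : size (take p s) = minn p (size s) by rewrite size_take_min.
have [sp|ps] := ltnP (size s) p.
  have t0 : t = 0%N by rewrite /t nth_default ?Wn // size_map sz; lia.
  rewrite t0; split; rewrite ?sz;
    [by rewrite take_uniq // sort_uniq enum_uniq|exact: geq_minl| |by left|].
    by move=> j /mem_take; rewrite ms => /eqP.
  by move=> j /eqP; rewrite -ms => js; left; rewrite take_oversize // ltnW.
have szp : size (take p s) = p by rewrite sz; lia.
have [z tE] : exists z, t = w (nth z (take p s) p.-1).
  case E: (take p s) szp => [|z0 l0] szp; first by move: p0; rewrite -szp.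
  by exists z0; rewrite /t E (nth_map z0) ?Ww // szp; lia.
split; rewrite ?szp //; [by rewrite take_uniq // sort_uniq enum_uniq| | by right|].
- move=> j jt; split; first by have := mem_take jt; rewrite ms => /eqP.
  have jsz : (index j (take p s) < p)%N by rewrite -[ltnRHS]szp index_mem.
  rewrite tE -[X in (_ <= w X)%N](nth_index z jt).
  have /= := @sorted_leq_nth _ r rtr (fun i => leqnn _) z _ (take_sorted p srt)
    (index j (take p s)) p.-1; apply; rewrite ?inE ?szp; lia.
- move=> j /eqP; rewrite -ms => js; have := js; rewrite -{1}(cat_take_drop p s) mem_cat.
  case/orP => [|jd]; [by left|right].
  have jsz : (index j (drop p s) < size s - p)%N by rewrite -size_drop index_mem.
  rewrite tE -[X in (w X <= _)%N](nth_index z jd) nth_take ?nth_drop; last by lia.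
  have /= := @sorted_leq_nth _ r rtr (fun i => leqnn _) z _ srt
    p.-1 (p + index j (drop p s)); apply; rewrite ?inE; lia.
Qed.

End TopItems.

(** A valid inequality violated by more than [eps] yields a guess through [top_items]. Let [v] be
    the cost of its support at the offered coefficients. The optimal set for [v] covers at least as
    much weight, so its candidate is valid by exchange; it is violated by [rounded_cost], against
    [refuted]. *)
Lemma separation_complete (R : realType) n p w0 (w : 'I_n -> nat) (eps : R)
    (x : 'I_n -> R) (W u : nat -> nat) :
  (0 < p)%N -> 0 < eps -> (forall j : 'I_n, W j = w j) -> W n = 0%N ->
  (forall j : 'I_n, (u j)%:R * eps <= (p * n)%:R * x j < (u j).+1%:R * eps) ->
  (forall g, (forall m, g m <= n)%N -> (forall m, (p * p <= m)%N -> g m = 0%N) ->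
     refuted p w0 w x W u g) ->
  forall a0 a, coefs_upto p a0 a -> valid (min_knapsack w0 w) a0 a ->
    a0%:R - eps <= lhs a x.
Proof.
move=> p0 eps0 Ww Wn ux ref a0 a coef va; rewrite leNgt; apply/negP => lt.
have [a0p ap] := coef.
have /fin_all_exists[l Hl] : forall k : 'I_p, _ := fun k => top_items a p0 Ww Wn k.+1.
(* Class [k] occupies [p] cells from [k * p] on; short lists are padded by [n]. Cells from [p * p]
   on get 0, the content of untouched memory. *)
pose g m := if (m < p * p)%N then
  nth n (map val (nth [::] [seq l k | k <- enum 'I_p] (m %/ p))) (m %% p) else 0%N.
have gE (k : 'I_p) i : (i < p)%N -> g (k * p + i)%N = nth n (map val (l k)) i.
  move=> ip; have kp := ltn_ord k; rewrite /g ifT; last by nia.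
  rewrite divnMDl // divn_small // addn0 modnMDl modn_small //.
  by rewrite (nth_map k) ?size_enum_ord // nth_ord_enum.
have gn m : (g m <= n)%N.
  rewrite /g; case: ifP => // _; set s := nth [::] _ _; case: (ltnP (m %% p) (size s)) => h.
    by move: s h => [//|z s'] h; rewrite (nth_map z) //; apply: ltnW; apply: ltn_ord.
  by rewrite nth_default // size_map.
have alE (k : 'I_p) (j : 'I_n) :
    allowed W p g k j = (w j <= W (nth n (map val (l k)) p.-1))%N || (j \in l k).
  rewrite /allowed gE ?prednK // Ww; congr (_ || _).
  have [_ lp _ _ _] := Hl k; apply/hasP/idP => [[i]|jl].
    rewrite mem_iota add0n => /= ip; rewrite gE // => /eqP.
    case: (ltnP i (size (l k))) => isz.
      by rewrite (nth_map j) // => /val_inj ->; rewrite mem_nth.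
    by rewrite nth_default ?size_map // => jn; have := ltn_ord j; rewrite jn ltnn.
  have jlp : (index j (l k) < p)%N by apply: leq_trans lp; rewrite index_mem.
  exists (index j (l k)); first by rewrite mem_iota.
  by rewrite gE // (nth_map j) ?index_mem // nth_index.
have g0 m : (p * p <= m)%N -> g m = 0%N by rewrite /g ltnNge => ->.
have [c [Hc Hv]] := ref g gn g0.
have cp j : (j < n)%N -> (c j <= p)%N.
  by move=> /Hc [_]; case: (c j) => // m /(_ isT)[].
(* The guess permits the class that [j] has in [a], as [j] is listed there or no heavier than the
   threshold. The least permitted class offers no more. *)
have ca (j : 'I_n) : (0 < a j)%N -> (0 < c j <= a j)%N.
  case E: (a j) => [//|k] _; have kp : (k < p)%N by rewrite -E.
  have [+ _] := Hc j (ltn_ord j); apply => //.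
  rewrite (alE (Ordinal kp)); have [_ _ _ _ +] := Hl (Ordinal kp) => /(_ j E) [->|->] //.
  by rewrite orbT.
pose B j := oapp (fun i => 0 < a i)%N false (insub j : option 'I_n).
have BE (j : 'I_n) : B j = (0 < a j)%N by rewrite /B valK.
pose v := ksum n B (kcost u c).
have va_le : (v <= \sum_(j < n) a j * u j)%N.
  apply: leq_sum => j _; rewrite BE /kcost; case: posnP => [//|/ca/andP[_ h]].
  by rewrite mul1n leq_mul2r h orbT.
have vV : (v <= \sum_(j < n) p * u j)%N.
  by apply: leq_trans va_le _; apply: leq_sum => j _; rewrite leq_mul2r ap orbT.
have [A [[Av Aopt] HA]] := Hv v vV.
pose a' (j : 'I_n) := (A j * c j)%N.
have a'p j : (a' j <= p)%N by rewrite /a'; case: (A j); rewrite ?mul1n ?cp.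
have a0_gt0 : (0 < a0)%N.
  rewrite -(ltr0n R); apply: le_lt_trans (_ : lhs a x < _); last by lra.
  apply: sumr_ge0 => j _; rewrite mulr_ge0 //.
  have N0 : 0 < (p * n)%:R :> R by rewrite ltr0n muln_gt0 p0 (leq_trans _ (ltn_ord j)).
  rewrite -(pmulr_rge0 _ N0); apply: le_trans (_ : (u j)%:R * eps <= _).
    by rewrite mulr_ge0 // ltW.
  by case/andP: (ux j).
(* This contradicts [rounded_cost]; it will follow from [HA] once [a'] is shown to be valid. *)
suff : a0%:R <= lhs a' x.
  rewrite leNgt => /negP; apply.
  apply: rounded_cost eps0 p0 a'p ux _ lt.
  apply: leq_trans va_le; apply: leq_trans Av; apply: leq_sum => j _.
  by rewrite /a' /kcost mulnA.
have := HA a0.-1; rewrite prednK //; apply; first exact: a0p.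
pose S k := [set j in l k].
pose t k := W (nth n (map val (l k)) p.-1).
apply: (@exchange_valid n p w0 w a a' a0 S t) => //.
- by move=> k j; rewrite inE; have [_ _ H _ _] := Hl k => /H [].
- by move=> k j; rewrite inE; have [_ _ H _ _] := Hl k => /H [].
- move=> k; have [ul _ _ [H|H] _] := Hl k; [by left|right].
  by rewrite cardsE (card_uniqP ul).
- move=> k j a'j; have cj : c j = k.+1.
    by move: a'j; rewrite /a'; case: (A j); rewrite ?mul1n.
  have [_ ] := Hc j (ltn_ord j); rewrite cj => /(_ isT)[_] /=.
  by rewrite alE inE => /orP[]; [right|left].
have sumA : ksum n A (kval W c) = (\sum_(j | a' j != 0%N) w j)%N.
  rewrite /ksum [RHS]big_mkcond /=; apply: eq_bigr => j _.
  rewrite /kval /a' Ww; case: (A j); rewrite ?mul1n //.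
  by case: ifP.
have sumB : ksum n B (kval W c) = (\sum_(j | a j != 0%N) w j)%N.
  rewrite /ksum [RHS]big_mkcond /=; apply: eq_bigr => j _.
  rewrite /kval BE Ww -lt0n; case: posnP => //= /ca/andP[].
  by rewrite mul1n lt0n => /negPf ->.
(* The total weight is fixed, so covering more of it with positive coefficients leaves less at
   coefficient 0. *)
have := Aopt B (leqnn _); rewrite sumA sumB.
have E (b : 'I_n -> nat) :
    (\sum_j w j = \sum_(j | b j == 0) w j + \sum_(j | b j != 0) w j)%N.
  by rewrite (bigID (fun j => b j == 0%N)).
by have := E a; have := E a'; lia.
Qed.

(** * Knapsack table *)

(* One cell of the table: the optimum [d], and an optimal set coded by [k]. *)
Definition cell m (val cost : nat -> nat) v d k : Prop :=
  exists A, [/\ opt m val cost v A, d = ksum m A val & k = ksum m A (expn 2)].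

Lemma ksumS m A f : ksum m.+1 A f = (ksum m A f + A m * f m)%N.
Proof. exact: big_ord_recr. Qed.

Lemma eq_ksum m A B f g : (forall j, (j < m)%N -> A j = B j) ->
  (forall j, (j < m)%N -> f j = g j) -> ksum m A f = ksum m B g.
Proof. by move=> AB fg; apply: eq_bigr => j _; rewrite AB ?fg. Qed.

Lemma cell0 val cost v : cell 0 val cost v 0 0.
Proof.
exists xpred0; rewrite /opt /ksum !big_ord0; split=> //; split=> // B.
by rewrite !big_ord0.
Qed.

(** The case of the knapsack recurrence in which item [m] enters: the bound on [d] excludes a better
    set without it, and bit [m] joins the code. *)
Lemma cell_take m val cost v d k d' k' :
  (cost m <= v)%N -> cell m val cost v d k -> cell m val cost (v - cost m) d' k' ->
  (d <= d' + val m)%N -> cell m.+1 val cost v (d' + val m) (k' + 2 ^ m).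
Proof.
move=> cv [A [[Av Ao] -> _]] [A' [[A'v A'o] -> ->]] le.
pose A1 j := (j == m) || A' j.
have A1E f : ksum m.+1 A1 f = (ksum m A' f + f m)%N.
  rewrite ksumS {2}/A1 eqxx mul1n; congr addn; apply: eq_ksum => // j jm.
  by rewrite /A1 ltn_eqF.
exists A1; split; rewrite ?A1E //; split; first by rewrite A1E; lia.
move=> B; rewrite ksumS A1E ksumS; case: (B m); rewrite ?mul1n ?mul0n ?addn0.
  by move=> Bv; rewrite leq_add2r; apply: A'o; lia.
by move=> Bv; apply: leq_trans le; apply: Ao.
Qed.

Lemma cell_skip m val cost v d k :
  cell m val cost v d k ->
  ((cost m <= v)%N -> exists d' k', cell m val cost (v - cost m) d' k' /\ (d' + val m <= d)%N) ->
  cell m.+1 val cost v d k.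
Proof.
move=> [A [[Av Ao] -> ->]] H.
pose A1 j := (j != m) && A j.
have A1E f : ksum m.+1 A1 f = ksum m A f.
  rewrite ksumS {2}/A1 eqxx mul0n addn0; apply: eq_ksum => // j jm.
  by rewrite /A1 ltn_eqF.
exists A1; split; rewrite ?A1E //; split; first by rewrite A1E.
move=> B; rewrite ksumS A1E ksumS; case: (B m); rewrite ?mul1n ?mul0n ?addn0; last exact: Ao.
move=> Bv; have [|d' [k' [[A' [[A'v A'o] E _]] le]]] := H; first by lia.
by apply: leq_trans le; rewrite leq_add2r E; apply: A'o; lia.
Qed.

(* Integer arrays: 4 the guess; 5, 6, 7 loop counters; 8 the rounded [x]; 9 the
   coefficient on offer for each item; 10, 11 values and costs of the current
   knapsack and 16 its capacity; 12 its optima; 13, 14 its optimal sets, coded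
   in binary; 15, 19 scratch; 17 the largest total cost; 18 the powers of 2.
   Real array 2 is an accumulator.  All scalars sit in cell 0. *)
Local Notation nv := (IGet 0 (ICst 0)).
Local Notation jv := (IGet 5 (ICst 0)).
Local Notation iv := (IGet 6 (ICst 0)).
Local Notation capv := (IGet 16 (ICst 0)).
Local Notation tv := (IGet 19 (ICst 0)).

Definition knap_init := Seq (ISet 12 iv (ICst 0)) (ISet 13 iv (ICst 0)).
(** Capacities are treated from the largest down, so the row can be updated in place: the cell at
    the reduced capacity still belongs to the previous row, even for an item of cost 0. *)
Definition knap_step :=
  Seq (ISet 19 (ICst 0) (ISub capv iv))
    (If (BAnd (BILe (IGet 11 jv) tv)
           (BNot (BILe (IAdd (IGet 12 (ISub tv (IGet 11 jv))) (IGet 10 jv)) (IGet 12 tv))))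
       (Seq (ISet 13 tv (IAdd (IGet 13 (ISub tv (IGet 11 jv))) (IGet 18 jv)))
            (ISet 12 tv (IAdd (IGet 12 (ISub tv (IGet 11 jv))) (IGet 10 jv))))
       Skip).
Definition knap :=
  Seq (For 6 0 (IAdd capv (ICst 1)) knap_init)
      (For 5 0 nv (For 6 0 (IAdd capv (ICst 1)) knap_step)).
Definition Tknap n C :=
  (Tfor 4 C.+1 (ub knap_init) + Tfor 2 n (Tfor 4 C.+1 (ub knap_step)))%N.

Section Knap.
Variable R : realType.
Implicit Types (s : state R).

Lemma knapP n C Cm s val cost :
  imem s 0 0 = n -> imem s 16 0 = C -> (C <= Cm)%N ->
  (forall j, (j < n)%N -> imem s 10 j = val j) ->
  (forall j, (j < n)%N -> imem s 11 j = cost j) ->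
  (forall j, (j < n)%N -> imem s 18 j = 2 ^ j)%N ->
  wp (Tknap n Cm) knap s
    (fun s' => forall v, (v <= C)%N -> cell n val cost v (imem s' 12 v) (imem s' 13 v)).
Proof.
move=> En EC CCm Eval Ecost Epw; apply: wp_seq.
apply: (@wp_for_frame _ _ _ _ _ C.+1 _ _ _ _
  (fun i s' => forall v, (v < i)%N -> imem s' 12 v = 0%N /\ imem s' 13 v = 0%N)) => //.
- by move=> s' [H _] /=; rewrite H // EC addn1.
- move=> i s' iC S Ei IH; eapply wp_le; last exact: leqnn.
  apply: wp_seq; apply: wp_iset; apply: wp_iset => /=.
  rewrite /upd /= Ei => v; rewrite ltnS leq_eqVlt; case: eqP => //= _; exact: IH.
move=> s1 [S1 _] I1.
apply: (@wp_for_frame _ _ _ _ _ n _ _ _ _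
  (fun j s' => forall v, (v <= C)%N -> cell j val cost v (imem s' 12 v) (imem s' 13 v))) => //.
- by move=> s' [H _] /=; rewrite H // S1.
- by move=> v vC /=; rewrite /upd /=; have [-> ->] := I1 v vC; apply: cell0.
move=> j s2 jn [S2 _] Ej I2.
(* Cells with [v + i <= C] still belong to row [j], the others already to row [j.+1]. *)
apply: (@wp_for_frame _ _ _ _ _ C.+1 _ _ _ _
  (fun i s' => forall v, (v <= C)%N ->
     cell (if (v + i <= C)%N then j else j.+1) val cost v (imem s' 12 v) (imem s' 13 v))) => //.
- by move=> s' [H _] /=; rewrite H // S2 // S1 // EC addn1.
- by move=> v vC /=; rewrite /upd /= addn0 vC; apply: I2.
- move=> i s3 iC [S3 _] Ei I3.
  have E5 : imem s3 5 0 = j by rewrite S3.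
  have E10 : imem s3 10 j = val j by rewrite S3 // S2 // S1 // Eval.
  have E11 : imem s3 11 j = cost j by rewrite S3 // S2 // S1 // Ecost.
  have E18 : imem s3 18 j = (2 ^ j)%N by rewrite S3 // S2 // S1 // Epw.
  have E16 : imem s3 16 0 = C by rewrite S3 // S2 // S1 // EC.
  have iC' : (C - i + i <= C)%N by lia.
  have It := I3 _ (leq_subr i C); rewrite iC' in It.
  have It' : (cost j <= C - i)%N -> cell j val cost (C - i - cost j)
      (imem s3 12 (C - i - cost j)) (imem s3 13 (C - i - cost j)).
    by move=> le; have := I3 (C - i - cost j)%N; rewrite ifT; [apply; lia|lia].
  eapply wp_le; last exact: leqnn.
  apply: wp_seq; apply: wp_iset => /=; rewrite Ei E16.
  apply: wp_if => [|H].
    rewrite /= /upd /= E5 E10 E11 => /andP[le]; rewrite -ltnNge => lt.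
    apply: wp_seq; apply: wp_iset; apply: wp_iset => /= v vC.
    rewrite /upd /= E5 E10 E11 E18.
    have [->|nev] := eqVneq v (C - i)%N.
      by rewrite ifN; [apply: cell_take le It (It' le) _; exact: ltnW|lia].
    have -> : (v + i.+1 <= C)%N = (v + i <= C)%N by lia.
    exact: I3.
  apply: wp_skip => /= v vC; rewrite /upd /=.
  have [->|nev] := eqVneq v (C - i)%N.
    rewrite ifN; [|lia]; apply: cell_skip It _ => le.
    do 2 eexists; split; first exact: It' le.
    by move: H; rewrite /= /upd /= E5 E10 E11 le negbK.
  have -> : (v + i.+1 <= C)%N = (v + i <= C)%N by lia.
  exact: I3.
- move=> s3 [S3 _] I3 v vC /=; rewrite /upd /=.
  by have := I3 _ vC; rewrite ifN //; lia.
Qed.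

End Knap.

(** * Preprocessing and classes *)

Section Setup.
Variable R : realType.
Implicit Types (s : state R).

Definition pows :=
  Seq (ISet 18 (ICst 0) (ICst 1))
      (For 5 0 nv (ISet 18 (IAdd jv (ICst 1)) (IAdd (IGet 18 jv) (IGet 18 jv)))).
Definition Tpows n := (3 + Tfor 2 n 12)%N.

Lemma powsP n s : imem s 0 0 = n ->
  wp (Tpows n) pows s (fun s' => forall j, (j < n)%N -> imem s' 18 j = 2 ^ j)%N.
Proof.
move=> En; apply: wp_seq; apply: wp_iset.
apply: (@wp_for_in _ [:: 18] [::] _ _ _ _ n _ _ _ _
  (fun i s' => forall j, (j <= i)%N -> imem s' 18 j = 2 ^ j)%N) => //.
- by move=> s' [H _] /=; rewrite H.
- by move=> j; rewrite leqn0 => /eqP ->.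
- move=> i s' iN S Ei IH; eapply wp_le; last exact: leqnn.
  apply: wp_iset => _ j /=; rewrite /upd /= Ei addn1 leq_eqVlt.
  have [->|ne] := eqVneq j i.+1; last exact: IH.
  by rewrite IH // addnn expnS mul2n.
by move=> s' _ H j /ltnW; apply: H.
Qed.

(** Multiplication by a constant, written out as repeated addition; its cost does not depend on the
    input. *)
Fixpoint imul k e : iexp := if k is k'.+1 then IAdd (imul k' e) e else ICst 0.
Fixpoint rmul k e : rexp := if k is k'.+1 then RAdd (rmul k' e) e else RCst 0.

Lemma ieval_imul k e s : ieval s (imul k e) = (k * ieval s e)%N.
Proof. by elim: k => //= k ->; rewrite mulSn addnC. Qed.

Lemma reval_rmul k e s : reval s (rmul k e) = k%:R * reval s e.
Proof. by elim: k => /= [|k ->]; rewrite ?mul0r // -addn1 natrD mulrDl mul1r. Qed.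

Definition scale_sum p :=
  RSet 2 (ICst 0) (RAdd (RGet 2 (ICst 0)) (rmul p (RGet 1 (IAdd jv (ICst 1))))).
Definition scale_step :=
  Seq (RSet 2 (ICst 0) (RSub (RGet 2 (ICst 0)) (RGet 0 (ICst 0))))
      (ISet 8 jv (IAdd (IGet 8 jv) (ICst 1))).
(** Integer division without multiplication: the product of [p * n] and an entry of [x] by repeated
    addition, its quotient by [eps] by repeated subtraction. *)
Definition scale p :=
  For 5 0 nv
    (Seq (RSet 2 (ICst 0) (RCst 0))
    (Seq (For 6 0 nv (scale_sum p))
    (Seq (ISet 8 jv (ICst 0))
         (While (BRLe (RGet 0 (ICst 0)) (RGet 2 (ICst 0))) scale_step)))).
Definition Tscale p n U :=
  Tfor 2 n (3 + (Tfor 2 n (ub (scale_sum p)) + (4 + (U * (5 + ub scale_step).+1 + 6)))).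

Lemma scaleP p n U s eps :
  imem s 0 0 = n -> rmem s 0 0 = eps -> 0 < eps ->
  (forall j, (j < n)%N -> 0 <= rmem s 1 j.+1 <= 1) ->
  (p * n)%:R < U.+1%:R * eps ->
  wp (Tscale p n U) (scale p) s (fun s' => forall j, (j < n)%N ->
    (imem s' 8 j <= U)%N /\
    (imem s' 8 j)%:R * eps <= (p * n)%:R * rmem s 1 j.+1 < (imem s' 8 j).+1%:R * eps).
Proof.
move=> En Eeps eps0 x01 HU.
apply: (@wp_for_in _ [:: 6; 8] [:: 2] _ _ _ _ n _ _ _ _
  (fun i s' => forall j, (j < i)%N ->
    (imem s' 8 j <= U)%N /\
    (imem s' 8 j)%:R * eps <= (p * n)%:R * rmem s 1 j.+1 < (imem s' 8 j).+1%:R * eps)) => //.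
  by move=> s' [H _] /=; rewrite H.
move=> j s1 jn S1 Ej IH.
apply: wp_seq; apply: wp_rset; apply: wp_seq.
apply: (@wp_for_in _ [::] [:: 2] _ _ _ _ n _ _ _ _
  (fun i s' => rmem s' 2 0 = (p * i)%:R * rmem s 1 j.+1)) => //.
- by move=> s' [H _] /=; rewrite H // S1.1.
- by rewrite muln0 mul0r.
- move=> i s2 _ [S2 S2'] _ I2; apply: wp_rset => _ /=.
  rewrite /upd /= reval_rmul /= S2 //= Ej addn1 I2 S2' //= /upd /= S1.2 //.
  by rewrite mulnS natrD mulrDl addrC.
move=> s2 [S2 S2'] I2; apply: wp_seq; apply: wp_iset.
set s3 := iset _ _ _ _.
have E2j : imem s2 5 0 = j by rewrite S2.
(* Real array 2 holds the remainder, cell [j] of array 8 the quotient so far; [k] more subtractions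
   fit under the bound [U]. *)
pose J k s' := [/\ same [:: 8] [:: 2] s3 s',
  forall i, i != j -> imem s' 8 i = imem s1 8 i,
  (imem s' 8 j + k = U)%N, 0 <= rmem s' 2 0 &
  rmem s' 2 0 + (imem s' 8 j)%:R * eps = (p * n)%:R * rmem s 1 j.+1].
apply: (@wp_while _ _ U _ _ _ _ J).
- split; first exact: same_refl.
  + by move=> i ij; rewrite /s3 /= /upd /= E2j (negPf ij) S2.
  + by rewrite /s3 /= /upd /= E2j eqxx.
  + by rewrite /= I2 mulr_ge0 //; case/andP: (x01 j jn).
  + by rewrite /= I2 /upd /= E2j eqxx mul0r addr0.
- move=> k s' [S' Ho Hk H0 Hs] /=.
  have Ee : rmem s' 0 0 = eps by rewrite S'.2 //= S2' //= /upd /= S1.2.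
  have Ej' : imem s' 5 0 = j by rewrite S'.1.
  rewrite Ee => le.
  (* The increased quotient times [eps] is at most [p * n], because entries of [x] are at most 1,
     and [p * n] is below [U.+1] times [eps]. *)
  have cU : (imem s' 8 j < U)%N.
    rewrite -ltnS -(ltr_nat R) -(ltr_pM2r eps0); apply: le_lt_trans HU.
    apply: (@le_trans _ _ ((p * n)%:R * rmem s 1 j.+1)).
      by rewrite -Hs -[in leLHS]addn1 natrD mulrDl mul1r; lra.
    by rewrite ler_piMr //; case/andP: (x01 j jn).
  split; first by lia.
  eapply wp_le; last exact: leqnn.
  apply: wp_seq; apply: wp_rset; apply: wp_iset => /=; rewrite Ej' Ee.
  split.
  + apply: same_trans S' _; apply: same_trans (_ : same _ _ s' (rset s' 2 0 (rmem s' 2 0 - eps))) _.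
      exact: same_rset.
    exact: same_iset.
  + by move=> i ij; rewrite /= /upd /= (negPf ij) Ho.
  + by rewrite /= /upd /= eqxx; lia.
  + by rewrite /= /upd /= subr_ge0.
  + rewrite /= /upd /= eqxx -Hs natrD; ring.
- move=> k s4 [S4 Ho Hk H0 Hs] /=.
  have Ee : rmem s4 0 0 = eps by rewrite S4.2 //= S2' //= /upd /= S1.2.
  rewrite Ee -ltNge => lt S4' i; rewrite ltnS /upd /= => ij.
  have [->|ne] := eqVneq i j; last by rewrite Ho //; apply: IH; rewrite ltn_neqAle ne.
  split; first by lia.
  by rewrite -Hs -[(imem s4 8 j).+1]addn1 natrD mulrDl mul1r; apply/andP; split; lra.
Qed.

Definition capacity p :=
  Seq (ISet 17 (ICst 0) (ICst 0))
      (For 5 0 nv (ISet 17 (ICst 0) (IAdd (IGet 17 (ICst 0)) (imul p (IGet 8 jv))))).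
Definition Tcapacity p n :=
  (3 + Tfor 2 n (ub (ISet 17 (ICst 0) (IAdd (IGet 17 (ICst 0)) (imul p (IGet 8 jv))))))%N.

Lemma capacityP p n s : imem s 0 0 = n ->
  wp (Tcapacity p n) (capacity p) s
    (fun s' => imem s' 17 0 = \sum_(j < n) p * imem s 8 j)%N.
Proof.
move=> En; apply: wp_seq; apply: wp_iset.
apply: (@wp_for_in _ [:: 17] [::] _ _ _ _ n _ _ _ _
  (fun i s' => imem s' 17 0 = \sum_(j < i) p * imem s 8 j)%N) => //.
- by move=> s' [H _] /=; rewrite H.
- by rewrite big_ord0.
- move=> i s' _ S Ei Ii; apply: wp_iset => _.
  by rewrite /= /upd /= ieval_imul /= Ii Ei big_ord_recr /= S.1.
Qed.

Definition guessv k := IGet 4 (ICst k).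

Fixpoint unguessed k q : bexp :=
  if q is q'.+1 then
    BAnd (unguessed k q')
         (BNot (BAnd (BILe jv (guessv (k + q'))) (BILe (guessv (k + q')) jv)))
  else BILe (ICst 0) (ICst 0).

(** A disjunction, by De Morgan. Item [j] has its weight in cell [j + 1], so the guess [n] reads
    cell [n + 1], which is 0 in the input. *)
Definition allowedb p k : bexp :=
  BNot (BAnd (BNot (BILe (IGet 1 (IAdd jv (ICst 1)))
                         (IGet 1 (IAdd (guessv (k * p + p.-1)) (ICst 1)))))
             (unguessed (k * p) p)).

Lemma allowedbP p k s :
  beval s (allowedb p k) =
  allowed (fun j => imem s 1 j.+1) p (imem s 4) k (imem s 5 0).
Proof.
have E q : ~~ beval s (unguessed (k * p) q) =
    has (fun i => imem s 5 0 == imem s 4 (k * p + i)) (iota 0 q).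
  elim: q => [|q IH] //; rewrite -addn1 iotaD has_cat addn1 /= orbF add0n negb_and negbK IH.
  by rewrite eqn_leq.
by rewrite /= negb_and negbK /allowed !addn1 E.
Qed.

Lemma bcost_allowedb p k : bcost (allowedb p k) = (17 + p * 13)%N.
Proof.
have E q : bcost (unguessed (k * p) q) = (3 + q * 13)%N by elim: q => //= q ->; lia.
by rewrite /allowedb /= E; lia.
Qed.

Definition assign k : cmd :=
  Seq (ISet 9 jv (ICst k))
  (Seq (ISet 11 jv (imul k (IGet 8 jv)))
       (ISet 10 jv (if k is 0 then ICst 0 else IGet 1 (IAdd jv (ICst 1))))).

(** Classes are tried in descending order, starting from coefficient 0, so the last assignment made
    is the cheapest class permitted. *)
Definition classes p : cmd :=
  For 5 0 nv
    (Seq (assign 0) (unroll p (fun k => If (allowedb p k) (assign k.+1) Skip))).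
Definition Tclasses p n : nat :=
  Tfor 2 n (ub (assign 0) + (p * (17 + p * 13 + ub (assign p)).+1).+1).

Lemma ub_assign k p : (k <= p)%N -> (ub (assign k) <= ub (assign p))%N.
Proof.
move=> kp; have E q e : icost (imul q e) = (q * (icost e).+1 + 1)%N.
  by elim: q => //= q ->; lia.
by case: k p kp => [|k] [|p] //=; rewrite ?E /=; lia.
Qed.

Lemma assignP k s j : imem s 5 0 = j ->
  wp (ub (assign k)) (assign k) s (fun s' =>
    [/\ same [:: 9; 10; 11] [::] s s',
     forall i, i != j -> [/\ imem s' 9 i = imem s 9 i, imem s' 10 i = imem s 10 i &
       imem s' 11 i = imem s 11 i],
     imem s' 9 j = k, imem s' 10 j = (if k == 0 then 0 else imem s 1 j.+1)%N &
     imem s' 11 j = (k * imem s 8 j)%N]).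
Proof.
move=> Ej; eapply wp_le; last exact: leqnn.
apply: wp_seq; apply: wp_iset; apply: wp_seq; apply: wp_iset; apply: wp_iset.
split.
- by split=> // a; rewrite !inE !negb_or /= /upd => /and3P[/negPf -> /negPf -> /negPf ->].
- by move=> i ij; rewrite /= /upd /= Ej (negPf ij).
- by rewrite /= /upd /= Ej eqxx.
- by rewrite /= /upd /= Ej eqxx; case: (k) => //= k'; rewrite /upd /= ?Ej addn1.
- by rewrite /= /upd /= Ej eqxx ieval_imul /= /upd /= Ej.
Qed.

Lemma classesP p n s : imem s 0 0 = n ->
  let W j := imem s 1 j.+1 in
  wp (Tclasses p n) (classes p) s (fun s' => forall j, (j < n)%N ->
    [/\ least_class W p (imem s 4) 0 j (imem s' 9 j),
        imem s' 10 j = kval W (imem s' 9) j &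
        imem s' 11 j = kcost (imem s 8) (imem s' 9) j]).
Proof.
move=> En W.
pose good i j s' :=
  [/\ least_class W p (imem s 4) i j (imem s' 9 j),
      imem s' 10 j = kval W (imem s' 9) j &
      imem s' 11 j = kcost (imem s 8) (imem s' 9) j].
apply: (@wp_for_in _ [:: 9; 10; 11] [::] _ _ _ _ n _ _ _ _
  (fun i s' => forall j, (j < i)%N -> good 0 j s')) => //.
- by rewrite /= all_unroll.
- by rewrite /= all_runroll.
- by move=> s' [H _] /=; rewrite H.
move=> j s1 jn S1 Ej IH; apply: wp_seq.
apply: wp_mono (assignP 0 Ej) (leqnn _) _ => s2 _ [S2 Ho E9 E10 E11].
(* Items before [j] are settled; for [j] the classes from [i] on have been tried. *)
pose I i s' := [/\ same [:: 9; 10; 11] [::] s1 s',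
  forall k, (k < j)%N -> good 0 k s' & good i j s'].
apply: (@wp_unroll _ _ _ _ _ _ I).
- split=> //.
    move=> k kj; rewrite /good /kval /kcost; have [|-> -> ->] := Ho k; first by rewrite ltn_eqF.
    exact: IH.
  rewrite /good /kval /kcost E9 E10 E11; split=> //; split=> // k.
  by rewrite leqNgt; case: ltnP.
- move=> k s3 kp [S3 I3 G3].
  have Ej3 : imem s3 5 0 = j by rewrite S3.1.
  have Eal : beval s3 (allowedb p k) = allowed W p (imem s 4) k j.
    rewrite allowedbP Ej3 /allowed /W !(S3.1 _ _ _, S1.1 _ _ _) //.
    by congr (_ || _); apply: eq_has => i; rewrite S3.1 // S1.1.
  eapply wp_le; first apply: (@wp_if _ (ub (assign p)) 1).
  + rewrite Eal => al; apply: wp_mono (assignP k.+1 Ej3) _ _; first exact: ub_assign.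
    move=> s4 _ [S4 Ho4 E9' E10' E11']; split.
    * exact: same_trans S3 S4.
    * move=> i ij; rewrite /good /kval /kcost; have [|-> -> ->] := Ho4 i; first by rewrite ltn_eqF.
      exact: I3.
    * rewrite /good /kval /kcost E9' E10' E11' /W !(S3.1 _ _ _, S1.1 _ _ _) //.
      split=> //; split=> [i /andP[ki _] _|_]; [by rewrite ltnS|by split].
  + rewrite Eal => al; apply: wp_skip; split=> //.
    have [[G31 G32] ? ?] := G3; split=> //; split=> // i /andP[ki ip].
    move: ki; rewrite leq_eqVlt => /predU1P[<-|ki]; first by rewrite (negPf al).
    by apply: G31; rewrite ki.
  + by rewrite bcost_allowedb; have : (0 < ub (assign p))%N by []; lia.
move=> s' [_ I0 G0] _ i; rewrite ltnS leq_eqVlt => /predU1P[->|]; [exact: G0|exact: I0].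
Qed.

End Setup.

(** * Candidates and guesses *)

(** The bits below [m] add up to less than [2 ^ m], so in decoding one comparison decides the top
    bit. *)
Lemma ksum_pow_lt m A : (ksum m A (expn 2) < 2 ^ m)%N.
Proof.
elim: m => [|m IH]; first by rewrite /ksum big_ord0.
by rewrite ksumS expnS; case: (A m); lia.
Qed.

Lemma refuted_ext (R : realType) n p w0 w (x : 'I_n -> R) W u g g' :
  g =1 g' -> refuted p w0 w x W u g -> refuted p w0 w x W u g'.
Proof.
move=> gg' [c [Hc Hv]]; exists c; split=> // j /Hc.
have E k : allowed W p g' k j = allowed W p g k j.
  by rewrite /allowed gg'; congr (_ || _); apply: eq_has => i; rewrite gg'.
by case=> H1 H2; split=> [k|]; rewrite E //; apply: H1.
Qed.

(** Runs from the last item down. It also sets up the second knapsack, with weights as values and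
    the coefficients of the candidate as costs. *)
Definition decode_step :=
  Seq (ISet 6 (ICst 0) (ISub (ISub nv jv) (ICst 1)))
  (Seq (ISet 10 iv (IGet 1 (IAdd iv (ICst 1))))
       (If (BILe (IGet 18 iv) (IGet 15 (ICst 0)))
          (Seq (ISet 15 (ICst 0) (ISub (IGet 15 (ICst 0)) (IGet 18 iv)))
               (ISet 11 iv (IGet 9 iv)))
          (ISet 11 iv (ICst 0)))).
Definition decode :=
  Seq (ISet 15 (ICst 0) (IGet 14 (IGet 7 (ICst 0)))) (For 5 0 nv decode_step).
Definition Tdecode n := (5 + Tfor 2 n (ub decode_step))%N.

Definition rsum_step :=
  RSet 2 (ICst 0) (RAdd (RGet 2 (ICst 0)) (RGet 1 (IAdd jv (ICst 1)))).
Definition rsum :=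
  Seq (RSet 2 (ICst 0) (RCst 0)) (For 5 0 nv (For 6 0 (IGet 11 jv) rsum_step)).
Definition Trsum p n := (3 + Tfor 2 n (Tfor 3 p (ub rsum_step)))%N.

Definition out_step := ISet 3 (IAdd jv (ICst 1)) (IGet 11 jv).
(** To violate the right-hand side [m.+1] means to cost at most [m]. So validity asks that the
    greatest weight at capacity [m], found in array 12, be below [w0]. *)
Definition test m :=
  If (BAnd (BNot (BILe (IGet 1 (ICst 0)) (IGet 12 (ICst m))))
           (BNot (BRLe (RCst m.+1) (RGet 2 (ICst 0)))))
    (Seq (ISet 2 (ICst 0) (ICst 1))
    (Seq (ISet 3 (ICst 0) (ICst m.+1)) (For 5 0 nv out_step)))
    Skip.
Definition Ttest n := (12 + maxn (3 + (3 + Tfor 2 n (ub out_step))) 1).+1.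

Definition cand p :=
  Seq decode (Seq (ISet 16 (ICst 0) (ICst p.-1)) (Seq knap (Seq rsum (unroll p test)))).
Definition Tcand p n : nat :=
  Tdecode n + (3 + (Tknap n p + (Trsum p n + (p * Ttest n).+1))).

Local Notation Vv := (IGet 17 (ICst 0)).
(** The optimal sets move to array 14 because the second knapsack, inside [cand], overwrites array
    13. *)
Definition body p :=
  Seq (classes p)
  (Seq (ISet 16 (ICst 0) Vv)
  (Seq knap
  (Seq (For 5 0 (IAdd Vv (ICst 1)) (ISet 14 jv (IGet 13 jv)))
       (For 7 0 (IAdd Vv (ICst 1)) (cand p))))).
Definition Tbody p n V : nat :=
  Tclasses p n + (4 + (Tknap n V + (Tfor 4 V.+1 6 + Tfor 4 V.+1 (Tcand p n)))).

(** The guess cells themselves serve as loop counters, so [m] nested loops run through all values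
    from 0 to [n] of the first [m] cells. *)
Fixpoint nest p m :=
  if m is m'.+1 then For 4 m' (IAdd nv (ICst 1)) (nest p m') else body p.
Fixpoint Tnest p n V m :=
  if m is m'.+1 then Tfor 4 n.+1 (Tnest p n V m') else Tbody p n V.

(** * Correctness of the search *)

Section Search.
Variable R : realType.
Implicit Types (s : state R).

Lemma decodeP n s A :
  imem s 0 0 = n -> imem s 14 (imem s 7 0) = ksum n A (expn 2) ->
  (forall j, (j < n)%N -> imem s 18 j = 2 ^ j)%N ->
  wp (Tdecode n) decode s (fun s' => forall j, (j < n)%N ->
    imem s' 11 j = (A j * imem s 9 j)%N /\ imem s' 10 j = imem s 1 j.+1).
Proof.
move=> En EA Epw; apply: wp_seq; apply: wp_iset.
apply: (@wp_for_in _ [:: 6; 10; 11; 15] [::] _ _ _ _ n _ _ _ _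
  (fun i s' => imem s' 15 0 = ksum (n - i) A (expn 2) /\
     forall j, (n - i <= j < n)%N ->
       imem s' 11 j = (A j * imem s 9 j)%N /\ imem s' 10 j = imem s 1 j.+1)) => //.
- by move=> s' [H _] /=; rewrite H.
- rewrite subn0; split; first by rewrite /= /upd /= EA.
  by move=> j; rewrite ltnNge => /andP[->].
- move=> i s' iN [S _] Ei [E15 IH]; eapply wp_le; last exact: leqnn.
  apply: wp_seq; apply: wp_iset; apply: wp_seq; apply: wp_iset.
  have -> : ieval s' (ISub (ISub nv jv) (ICst 1)) = (n - i.+1)%N.
    by rewrite /= S //= /upd /= En Ei; lia.
  set k := (n - i.+1)%N; have kn : (k < n)%N by lia.
  have Ek : (n - i = k.+1)%N by lia.
  have E18 : imem s' 18 k = (2 ^ k)%N by rewrite S //= /upd /= Epw.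
  have E9 : imem s' 9 k = imem s 9 k by rewrite S.
  have E1 : imem s' 1 (k + 1) = imem s 1 k.+1 by rewrite S // addn1.
  rewrite Ek ksumS in E15.
  have lt := ksum_pow_lt k A.
  have IH' j : (k <= j < n)%N -> j != k ->
      imem s' 11 j = (A j * imem s 9 j)%N /\ imem s' 10 j = imem s 1 j.+1.
    by move=> /andP[kj jn] jk; apply: IH; rewrite Ek ltn_neqAle eq_sym jk kj.
  apply: wp_if; rewrite /= /upd /= E18 E15.
    move=> le; have Ak : A k by case: (A k) E15 le => //; lia.
    apply: wp_seq; apply: wp_iset; apply: wp_iset => _ /=; rewrite /upd /= E15 E18 Ak E9 E1.
    split; first by lia.
    move=> j jk; have [->|ne] := eqVneq j k; first by rewrite Ak mul1n.
    exact: IH'.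
  rewrite -ltnNge => gt; have Ak : A k = false by case: (A k) E15 gt => //; lia.
  apply: wp_iset => _ /=; rewrite /upd /= E15 Ak E1.
  split; first by lia.
  move=> j jk; have [->|ne] := eqVneq j k; first by rewrite Ak mul0n.
  exact: IH'.
- by move=> s' _ [_ H] j jn; apply: H; rewrite subnn.
Qed.

Lemma rsumP p n s :
  imem s 0 0 = n -> (forall j, (j < n)%N -> imem s 11 j <= p)%N ->
  wp (Trsum p n) rsum s (fun s' =>
    rmem s' 2 0 = \sum_(j < n) (imem s 11 j)%:R * rmem s 1 j.+1).
Proof.
move=> En cp; apply: wp_seq; apply: wp_rset.
apply: (@wp_for_in _ [:: 6] [:: 2] _ _ _ _ n _ _ _ _
  (fun i s' => rmem s' 2 0 = \sum_(j < i) (imem s 11 j)%:R * rmem s 1 j.+1)) => //.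
- by move=> s' [H _] /=; rewrite H.
- by rewrite big_ord0.
move=> j s1 jn S1 Ej I1.
apply: (@wp_for_in _ [::] [:: 2] _ _ _ _ (imem s 11 j) _ _ _ _
  (fun i s' => rmem s' 2 0 = rmem s1 2 0 + i%:R * rmem s 1 j.+1)) => //.
- by move=> s' [H _] /=; rewrite H //= H // Ej S1.1.
- exact: cp.
- by rewrite mul0r addr0.
- move=> i s2 _ S2 _ I2; apply: wp_rset => _ /=; rewrite /upd /= I2.
  rewrite S2.1 // Ej addn1 (S2.2 1) // (S1.2 1) //= /upd /=.
  by rewrite -natr1 mulrDl mul1r addrA.
by move=> s2 _ I2 _ /=; rewrite I2 I1 big_ord_recr.
Qed.

Variables (p n w0 : nat) (w : 'I_n -> nat) (eps : R) (x : 'I_n -> R).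
Let s0 := input w0 w eps x.
Let W j := imem s0 1 j.+1.

Definition env s :=
  [/\ imem s 0 =1 imem s0 0, imem s 1 =1 imem s0 1,
      rmem s 0 =1 rmem s0 0 & rmem s 1 =1 rmem s0 1].

Lemma env_same l rl s s' : all (fun a => 1 < a)%N l -> all (fun a => 1 < a)%N rl ->
  same l rl s s' -> env s -> env s'.
Proof.
move=> lP rlP [H1 H2] [E0 E1 F0 F1].
have nl a (t : seq nat) : all (fun a => 1 < a)%N t -> (a <= 1)%N -> a \notin t.
  by move=> /allP tP a1; apply/negP => /tP; rewrite ltnNge a1.
by split=> i; rewrite ?(H1 _ (nl _ _ lP _)) ?(H2 _ (nl _ _ rlP _)).
Qed.

Lemma env_n s : env s -> imem s 0 0 = n.
Proof. by case=> ->. Qed.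

Lemma env_w s (j : 'I_n) : env s -> imem s 1 j.+1 = w j.
Proof. by case=> _ -> _ _ /=; rewrite valK. Qed.

Lemma env_x s (j : 'I_n) : env s -> rmem s 1 j.+1 = x j.
Proof. by case=> _ _ _ -> /=; rewrite valK. Qed.

Let K := min_knapsack w0 w.

Definition sound s :=
  verdict s = 0%N \/ verdict s = 1%N /\
  [/\ coefs_upto p (out_rhs s) (@out_coef R n s), valid K (out_rhs s) (@out_coef R n s)
    & lhs (@out_coef R n s) x < (out_rhs s)%:R].

(* Once an inequality is found it may be overwritten, but only by another one. *)
Definition better s s' := sound s' /\ (verdict s = 1%N -> verdict s' = 1%N).

Lemma better_trans s1 s2 s3 : better s1 s2 -> better s2 s3 -> better s1 s3.
Proof. by move=> [_ H1] [H2 H3]; split=> // /H1. Qed.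

(** Carries verdict 0 backwards, which makes facts conditional on it in an earlier state available
    later. *)
Lemma better0 s s' : better s s' -> sound s -> verdict s' = 0%N -> verdict s = 0%N.
Proof. by move=> [_ H] [->//|[/H -> _]]. Qed.

Lemma valid_ext m (L : {set {ffun 'I_n -> bool}}) a b : a =1 b -> valid L m a -> valid L m b.
Proof. by move=> ab H y /H; under eq_bigr do rewrite ab. Qed.

Lemma lhs_ext (a b : 'I_n -> nat) (y : 'I_n -> R) : a =1 b -> lhs a y = lhs b y.
Proof. by move=> ab; apply: eq_bigr => j _; rewrite ab. Qed.

Lemma sound_same s s' : imem s' 2 0 = imem s 2 0 -> imem s' 3 =1 imem s 3 ->
  sound s -> sound s'.
Proof.
rewrite /sound /verdict /out_rhs => -> E3.
have E : @out_coef R n s' =1 @out_coef R n s by move=> j; rewrite /out_coef E3.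
rewrite E3 (lhs_ext _ E) => -[->|[-> [[? C] V L]]]; [by left|right; split=> //; split=> //].
  by split=> // j; rewrite E.
by apply: valid_ext V => j; rewrite E.
Qed.

Lemma better_same s s' : imem s' 2 0 = imem s 2 0 -> imem s' 3 =1 imem s 3 ->
  sound s -> better s s'.
Proof. by move=> E2 E3 /(sound_same E2 E3) H; split=> //; rewrite /verdict E2. Qed.

Lemma testP s (a : 'I_n -> nat) m :
  env s -> sound s -> (m < p)%N ->
  (forall j : 'I_n, imem s 11 j = a j) -> (forall j, a j <= p)%N ->
  rmem s 2 0 = lhs a x ->
  ((imem s 12 m < w0)%N -> valid K m.+1 a) ->
  wp (Ttest n) (test m) s (fun s' => better s s' /\
    (verdict s' = 0%N -> (imem s 12 m < w0)%N -> m.+1%:R <= lhs a x)).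
Proof.
move=> Es Ss mp Ea ap El Ev; have En := env_n Es.
have Ew0 : imem s 1 0 = w0 by case: Es => _ -> _ _.
apply: wp_if; last first.
  rewrite /= -ltnNge -ltNge Ew0 El negb_and -leqNgt -leNgt => H.
  apply: wp_skip; split; first by split.
  by move=> _ lt; move: H; rewrite leqNgt lt.
rewrite /= -ltnNge -ltNge Ew0 El => /andP[/Ev va lt].
apply: wp_seq; apply: wp_iset; apply: wp_seq; apply: wp_iset.
apply: (@wp_for_in _ [:: 3] [::] _ _ _ _ n _ _ _ _
  (fun i s' => imem s' 3 0 = m.+1 /\ forall j, (j < i)%N -> imem s' 3 j.+1 = imem s 11 j)) => //.
- by move=> s' [H _] /=; rewrite H.
- move=> i s' iN S Ei [I0 I1]; apply: wp_iset => _ /=; rewrite /upd /= Ei addn1 /=.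
  split=> // j; rewrite ltnS eqSS; have [-> _|ne ji] := eqVneq j i; first by rewrite S.1.
  by apply: I1; rewrite ltn_neqAle ne.
move=> s' [S _] [I0 I1].
have V1 : verdict s' = 1%N by rewrite /verdict S.
have E : @out_coef R n s' =1 a by move=> j; rewrite /out_coef I1 // Ea.
split; last by rewrite V1.
split=> //; right; split=> //; rewrite /out_rhs I0 (lhs_ext _ E); split=> //.
  by split=> // j; rewrite E.
by apply: valid_ext va => j; rewrite E.
Qed.

Lemma candP s (A : nat -> bool) :
  env s -> sound s -> (0 < p)%N ->
  imem s 14 (imem s 7 0) = ksum n A (expn 2) ->
  (forall j, (j < n)%N -> imem s 18 j = 2 ^ j)%N ->
  (forall j, (j < n)%N -> imem s 9 j <= p)%N ->
  let a := (fun j : 'I_n => A j * imem s 9 j)%N in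
  wp (Tcand p n) (cand p) s (fun s' => better s s' /\
    (verdict s' = 0%N -> forall m, (m < p)%N -> valid K m.+1 a -> m.+1%:R <= lhs a x)).
Proof.
move=> Es Ss p0 EA Epw cp a.
have ap j : (a j <= p)%N by rewrite /a; case: (A j); rewrite ?mul1n ?cp.
apply: wp_seq; apply: wp_mono (decodeP (env_n Es) EA Epw) (leqnn _) _ => s1 S1 I1.
have Es1 : env s1 by apply: env_same S1 Es.
apply: wp_seq; apply: wp_iset; set s2 := iset _ _ _ _.
have Es2 : env s2 by apply: (@env_same [:: 16] [::] s1) => //; apply: same_iset.
have E11 (j : 'I_n) : imem s2 11 j = a j.
  by have [E _] := I1 j (ltn_ord j); rewrite /s2 /= /upd /= E.
apply: wp_seq; eapply wp_mono; first apply: (@knapP R n p.-1 p s2 (imem s2 10) (imem s2 11)).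
- exact: env_n.
- by rewrite /s2 /= /upd.
- exact: leq_pred.
- by [].
- by [].
- by move=> j jn; rewrite /s2 /= /upd /= S1.1 ?Epw.
- exact: leqnn.
move=> s3 S3 I3; have Es3 : env s3 by apply: env_same S3 Es2.
have E11' (j : 'I_n) : imem s3 11 j = a j by rewrite S3.1 // E11.
(* A point of [K] violating [m.+1] is a set of cost at most [m] and weight at least [w0];
   conversely, an optimal set of weight at least [w0] is such a point. *)
have Ev m : (m < p)%N -> (imem s3 12 m < w0)%N <-> valid K m.+1 a.
  move=> mp; have [|B [[Bm Bo] EB _]] := I3 m; first by rewrite -ltnS prednK.
  have E10 (j : 'I_n) : imem s2 10 j = w j.
    by have [_ E] := I1 j (ltn_ord j); rewrite /s2 /= /upd /= E (env_w j Es).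
  rewrite EB; split=> [lt y|va].
    rewrite inE => wy; rewrite ltnNge; apply/negP => le.
    pose C j := oapp y false (insub j : option 'I_n).
    have CE (f : nat -> nat) (h : 'I_n -> nat) : (forall j : 'I_n, f j = h j) ->
        ksum n C f = (\sum_j h j * y j)%N.
      by move=> fh; apply: eq_bigr => j _; rewrite /C valK /= mulnC fh.
    have := Bo C; rewrite (CE _ _ E11) (CE _ _ E10) => /(_ le).
    by move/(leq_trans wy); rewrite leqNgt lt.
  rewrite ltnNge; apply/negP => wB.
  have /va : [ffun j : 'I_n => B j] \in K.
    rewrite inE; apply: leq_trans wB _; apply: leq_sum => j _.
    by rewrite ffunE E10 mulnC.
  rewrite ltnNge => /negP; apply; apply: leq_trans Bm; apply: leq_sum => j _.
  by rewrite ffunE E11 mulnC.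
apply: wp_seq; eapply wp_mono; first apply: (@rsumP p n s3).
- exact: env_n.
- by move=> j jn; have := E11' (Ordinal jn); rewrite /= => ->.
- exact: leqnn.
move=> s4 S4 I4; have Es4 : env s4 by apply: env_same S4 Es3.
have El : rmem s4 2 0 = lhs a x.
  by rewrite I4; apply: eq_bigr => j _; rewrite E11' (env_x j Es3).
have B4 : better s s4.
  apply: better_same => //; first by rewrite S4.1 // S3.1 // /s2 /= /upd /= S1.1.
  by move=> i; rewrite S4.1 // S3.1 // /s2 /= /upd /= S1.1.
pose I i s' := [/\ same [:: 2; 3; 5] [::] s4 s', better s s' &
  verdict s' = 0%N -> forall m, (i <= m < p)%N -> valid K m.+1 a -> m.+1%:R <= lhs a x].
apply: (@wp_unroll _ _ _ _ _ _ I).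
- by split=> // _ m; rewrite leqNgt; case: ltnP.
- move=> i s5 ip [S5 B5 H5].
  have E12 : imem s5 12 i = imem s3 12 i by rewrite S5.1 // S4.1.
  eapply wp_mono; first apply: (@testP s5 a i) => //.
  + by apply: env_same S5 Es4.
  + by case: B5.
  + by move=> j; rewrite S5.1 // S4.1.
  + by rewrite S5.2.
  + by rewrite E12 => /Ev; apply.
  + exact: leqnn.
  move=> s6 S6 [B6 H6]; split.
  + by apply: same_trans S5 _; apply: same_in S6.
  + exact: better_trans B5 B6.
  move=> V6 m /andP[]; rewrite leq_eqVlt => /predU1P[<- _|im mp].
    by move=> /(Ev _ ip) lt; apply: H6 => //; rewrite E12.
  apply: H5; last by rewrite im.
  by apply: better0 B6 _ V6; case: B5.
by move=> s5 [_ ? H]; split.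
Qed.

Definition prep u V s :=
  [/\ env s, forall j, (j < n)%N -> imem s 18 j = (2 ^ j)%N,
      forall j, (j < n)%N -> imem s 8 j = u j & imem s 17 0 = V].

Lemma prep_same u V l rl s s' :
  all (fun a => a \notin [:: 0; 1; 8; 17; 18]) l -> all (fun a => 1 < a)%N rl ->
  same l rl s s' -> prep u V s -> prep u V s'.
Proof.
move=> lP rlP S [Es E18 E8 E17].
have nl a : a \in [:: 0; 1; 8; 17; 18] -> a \notin l.
  by move=> al; apply/negP => /(allP lP); rewrite al.
split.
- apply: env_same S Es => //; apply: sub_all lP => a.
  by rewrite !inE !negb_or; case: a => [|[]].
- by move=> j jn; rewrite S.1 ?nl ?E18.
- by move=> j jn; rewrite S.1 ?nl ?E8.
- by rewrite S.1 ?nl.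
Qed.

Lemma bodyP s u V Vm :
  prep u V s -> sound s -> (0 < p)%N -> V = (\sum_(j < n) p * u j)%N -> (V <= Vm)%N ->
  wp (Tbody p n Vm) (body p) s (fun s' => better s s' /\
    (verdict s' = 0%N -> refuted p w0 w x W u (imem s 4))).
Proof.
move=> Ps Ss p0 EV VVm; have [Es E18 E8 E17] := Ps; have En := env_n Es.
apply: wp_seq; apply: wp_mono (classesP p En) (leqnn _) _ => s1 S1 I1.
have {}S1 : same [:: 5; 9; 10; 11] [::] s s1.
  by apply: same_in S1; rewrite /= ?all_cat ?all_unroll ?all_runroll.
apply: wp_seq; apply: wp_iset; set s2 := iset _ _ _ _.
have S2 : same [:: 5; 9; 10; 11; 16] [::] s s2.
  by apply: same_trans (same_in _ _ S1) (same_iset _ _ _ _ _).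
have EW j : imem s 1 j.+1 = W j by case: Es => _ -> _ _.
apply: wp_seq; eapply wp_mono; first apply: (@knapP R n V Vm s2
    (kval W (imem s1 9)) (kcost u (imem s1 9))) => //.
- by rewrite /s2 /= /upd /= S1.1.
- by rewrite /s2 /= /upd /= S1.1.
- by move=> j jn; have [_ + _] := I1 j jn; rewrite /s2 /= /upd /= => ->; rewrite /kval EW.
- by move=> j jn; have [_ _ +] := I1 j jn; rewrite /s2 /= /upd /= => ->; rewrite /kcost E8.
- by move=> j jn; rewrite /s2 /= /upd /= S1.1 ?E18.
- exact: leqnn.
move=> s3 S3 I3.
have S3' : same [:: 5; 6; 9; 10; 11; 12; 13; 16; 19] [::] s s3.
  by apply: same_trans (same_in _ _ S2) (same_in _ _ S3).
have E17' : imem s3 17 0 = V by rewrite S3'.1.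
apply: wp_seq.
apply: (@wp_for_in _ [:: 14] [::] _ _ _ _ V.+1 _ _ _ _
  (fun i s' => forall v, (v < i)%N -> imem s' 14 v = imem s3 13 v)) => //.
- by move=> s' [H _] /=; rewrite H // E17' addn1.
- move=> i s' iN S Ei I; apply: wp_iset => _ v /=; rewrite /upd /= Ei ltnS leq_eqVlt.
  by case: eqP => [-> _|_] /=; [rewrite S.1|exact: I].
move=> s4 S4 I4.
have S4' : same [:: 5; 6; 9; 10; 11; 12; 13; 14; 16; 19] [::] s s4.
  by apply: same_trans (same_in _ _ S3') (same_in _ _ S4).
have P4 : prep u V s4 by apply: prep_same S4' Ps.
have B4 : better s s4 by apply: better_same Ss; [|move=> i]; rewrite S4'.1.
have E9 j : imem s4 9 j = imem s1 9 j.
  by rewrite S4.1 // S3.1.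
have cl j : (j < n)%N -> least_class W p (imem s 4) 0 j (imem s1 9 j).
  move=> jn; have [[H1 H2] _ _] := I1 j jn.
  have E k : allowed W p (imem s 4) k j = allowed (fun j => imem s 1 j.+1) p (imem s 4) k j.
    by rewrite /allowed !EW.
  by split=> [k|c0]; rewrite E; [apply: H1|apply: H2].
have cp j : (j < n)%N -> (imem s1 9 j <= p)%N.
  by move=> /cl[_]; case: (imem s1 9 j) => // c /(_ isT)[].
(* The part of [refuted] for capacity [v], settled by one run of [cand]. *)
pose fine v := exists A, opt n (kval W (imem s1 9)) (kcost u (imem s1 9)) v A /\
  forall a0, (a0 < p)%N -> valid K a0.+1 (fun j : 'I_n => (A j * imem s1 9 j)%N) ->
    a0.+1%:R <= lhs (fun j : 'I_n => (A j * imem s1 9 j)%N) x.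
apply: (@wp_for_in _ [:: 2; 3; 5; 6; 10; 11; 12; 13; 15; 16; 19] [:: 2] _ _ _ _ V.+1 _ _ _ _
  (fun i s' => better s s' /\ (verdict s' = 0%N -> forall v, (v < i)%N -> fine v))) => //.
- by rewrite /= all_unroll.
- by rewrite /= all_runroll.
- by move=> s' [H _] /=; rewrite H // S4'.1 // E17 addn1.
- move=> i s5 iV S5 Ei [B5 H5].
  have [A [Ao _ Em]] := I3 i iV.
  have P5 : prep u V s5 by apply: prep_same S5 P4.
  have [Es5 E18' _ _] := P5.
  eapply wp_mono; first apply: (@candP s5 A) => //.
  + by case: B5.
  + by rewrite Ei S5.1 // I4.
  + by move=> j jn; rewrite S5.1 // E9 cp.
  + exact: leqnn.
  move=> s6 S6 [B6 H6] _; split.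
    apply: (better_trans B5); apply: (better_trans B6).
    by apply: better_same => //; case: B6.
  move=> V6 v; rewrite ltnS leq_eqVlt => /predU1P[->|].
    exists A; split=> // m mp.
    have Ea : (fun j : 'I_n => A j * imem s5 9 j)%N =1 (fun j : 'I_n => A j * imem s1 9 j)%N.
      by move=> j; rewrite S5.1 // E9.
    move=> va; rewrite -(lhs_ext _ Ea); apply: H6 => //.
    by apply: valid_ext va => j; rewrite Ea.
  apply: H5; apply: better0 B6 _ V6; by case: B5.
move=> s5 _ [B5 H5]; split=> // V5; exists (imem s1 9); split=> // v vV.
by apply: H5 => //; rewrite EV.
Qed.

Definition body_writes : seq nat := [:: 2; 3; 5; 6; 7; 9; 10; 11; 12; 13; 14; 15; 16; 19].

Lemma body_iwr : all (mem body_writes) (iwr (body p)).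
Proof. by rewrite /= ?all_cat /= ?all_cat !all_unroll. Qed.

Lemma body_rwr : all (mem [:: 2%N]) (rwr (body p)).
Proof. by rewrite /= ?all_cat /= ?all_cat !all_runroll. Qed.

Lemma nest_iwr m : all (mem (4%N :: body_writes)) (iwr (nest p m)).
Proof.
elim: m => [|m IH]; last by rewrite /= all_cat IH.
by apply: sub_all body_iwr => a; rewrite !inE => ->; rewrite orbT.
Qed.

Lemma nest_rwr m : all (mem [:: 2%N]) (rwr (nest p m)).
Proof. by elim: m => [|m IH] /=; [exact: body_rwr|rewrite all_cat IH]. Qed.

(** The surrounding loops fix the cells from [m] on, so the claim covers every guess that agrees
    with memory there. *)
Lemma nestP u V Vm m s :
  prep u V s -> sound s -> (0 < p)%N -> V = (\sum_(j < n) p * u j)%N -> (V <= Vm)%N ->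
  wp (Tnest p n Vm m) (nest p m) s (fun s' =>
    [/\ better s s', forall i, (m <= i)%N -> imem s' 4 i = imem s 4 i &
     verdict s' = 0%N -> forall g, (forall i, g i <= n)%N ->
       (forall i, (m <= i)%N -> g i = imem s 4 i) -> refuted p w0 w x W u g]).
Proof.
move=> Ps Ss p0 EV VVm; elim: m => [|m IH] /= in s Ps Ss *.
  apply: wp_mono (bodyP Ps Ss p0 EV VVm) (leqnn _) _ => s' S' [B' H']; split=> //.
    have {}S' := same_in body_iwr body_rwr S'.
    by move=> i _; rewrite S'.1.
  by move=> /H' r g _ gE; apply: refuted_ext r => i; rewrite gE.
have sub s1 s2 : same (4 :: iwr (nest p m)) (rwr (nest p m)) s1 s2 ->
    same (4%N :: body_writes) [:: 2] s1 s2.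
  by apply: same_in; rewrite ?nest_rwr //= nest_iwr.
(* The inner loops write array 4 too, so that they preserve the counter in cell [m] comes from the
   second clause of the induction hypothesis, not from the frame. *)
apply: (@wp_for _ _ _ _ _ n.+1 _ _ _ _
  (fun i s' => [/\ better s s', forall j, (m < j)%N -> imem s' 4 j = imem s 4 j &
     verdict s' = 0%N -> forall g, (forall i, g i <= n)%N -> (g m < i)%N ->
       (forall j, (m < j)%N -> g j = imem s 4 j) -> refuted p w0 w x W u g])) => //.
- move=> s' /sub S'; have Ps' : prep u V s' by apply: prep_same S' Ps.
  by have [Es' _ _ _] := Ps'; rewrite /= (env_n Es') addn1.
- split=> //.
  by move=> j mj; rewrite /= /upd eqxx gtn_eqF.
- move=> i s1 iN /sub S1 Ei [B1 E1 H1].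
  have P1 : prep u V s1 by apply: prep_same S1 Ps.
  apply: wp_mono (IH s1 P1 _) (leqnn _) _; first by case: B1.
  move=> s2 _ [B2 E2 H2]; split; first by rewrite E2.
  split.
  + apply: (better_trans B1); apply: (better_trans B2).
    by apply: better_same => //; case: B2.
  + by move=> j mj; rewrite /= /upd eqxx gtn_eqF //= E2 ?E1 // ltnW.
  move=> V2 g gn; rewrite ltnS leq_eqVlt => /predU1P[gm|gi] gE.
    apply: H2 => // j; rewrite leq_eqVlt => /predU1P[<-|mj]; first by rewrite gm Ei.
    by rewrite E1 // gE.
  by apply: H1 => //; apply: better0 B2 _ V2; case: B1.
move=> s' _ [B' E' H']; split=> // V' g gn gE.
by apply: H' => //; rewrite ltnS.
Qed.

End Search.

(** * Running time *)

Section PolynomialBound.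
Variables (R : realType) (p : nat).

(** [e] stands for [1 / eps]. The bound [U] on the rounded entries is at most [p * n * e], so a cost
    polynomial in [n] and [U] becomes polynomial in [n] and [e]. *)
Definition poly_bounded (f : nat -> nat -> nat) : Prop :=
  exists q : {poly {poly R}}, forall n U (e : R), 0 <= e ->
    U%:R <= (p * n)%:R * e -> (f n U)%:R <= q.[n%:R, e].

Lemma pb_const c : poly_bounded (fun _ _ => c).
Proof. by exists (c%:R%:P)%:P => n U e _ _; rewrite !hornerC. Qed.

Lemma pb_fst : poly_bounded (fun n _ => n).
Proof. by exists 'X => n U e _ _; rewrite hornerX hornerC. Qed.

Lemma pb_snd : poly_bounded (fun _ U => U).
Proof.
exists ((p%:R%:P)%:P * 'X * 'X%:P) => n U e _.
by rewrite !(hornerM, hornerC, hornerX) natrM.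
Qed.

Lemma pb_add f g : poly_bounded f -> poly_bounded g ->
  poly_bounded (fun n U => f n U + g n U)%N.
Proof.
move=> [q Hq] [r Hr]; exists (q + r) => n U e e0 HU.
by rewrite natrD !hornerD lerD ?Hq ?Hr.
Qed.

Lemma pb_succ f : poly_bounded f -> poly_bounded (fun n U => (f n U).+1).
Proof.
move=> Hf; have [q Hq] := pb_add Hf (pb_const 1); exists q => n U e e0 HU.
by rewrite -addn1; apply: Hq.
Qed.

Lemma pb_mul f g : poly_bounded f -> poly_bounded g ->
  poly_bounded (fun n U => f n U * g n U)%N.
Proof.
move=> [q Hq] [r Hr]; exists (q * r) => n U e e0 HU.
by rewrite natrM !hornerM ler_pM ?Hq ?Hr.
Qed.

Lemma pb_max f g : poly_bounded f -> poly_bounded g ->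
  poly_bounded (fun n U => maxn (f n U) (g n U)).
Proof.
move=> Hf Hg; have [q Hq] := pb_add Hf Hg; exists q => n U e e0 HU.
apply: le_trans (Hq n U e e0 HU); rewrite ler_nat; lia.
Qed.

Lemma pb_Tfor B N T : poly_bounded N -> poly_bounded T ->
  poly_bounded (fun n U => Tfor B (N n U) (T n U)).
Proof.
move=> HN HT; rewrite /Tfor.
by apply: pb_add (pb_mul HN (pb_add HT (pb_const _))) (pb_const _).
Qed.

End PolynomialBound.

Ltac poly_bound := lazymatch goal with
  | |- poly_bounded _ _ (fun _ _ => ?c) => apply: (pb_const _ _ c)
  | |- poly_bounded _ _ (fun n _ => n) => apply: pb_fst
  | |- poly_bounded _ _ (fun _ U => U) => apply: pb_snd
  | |- poly_bounded _ _ (fun _ _ => addn _ _) => apply: pb_add; poly_bound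
  | |- poly_bounded _ _ (fun _ _ => muln _ _) => apply: pb_mul; poly_bound
  | |- poly_bounded _ _ (fun _ _ => maxn _ _) => apply: pb_max; poly_bound
  | |- poly_bounded _ _ (fun _ _ => S _) => apply: pb_succ; poly_bound
  | |- poly_bounded _ _ (fun _ _ => Tfor _ _ _) => apply: pb_Tfor; poly_bound
  end.

Definition Talg p n U : nat :=
  Tpows n + (Tscale p n U + (Tcapacity p n + Tnest p n (n * (p * U)) (p * p))).

(** Each nesting level multiplies the time by a factor linear in [n], up to additive terms, and the
    depth [p * p] is fixed, so the degree depends on [p] alone. *)
Lemma Talg_bounded (R : realType) p : poly_bounded R p (Talg p).
Proof.
apply: pb_add; first by rewrite /Tpows; poly_bound.
apply: pb_add; first by rewrite /Tscale; poly_bound.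
apply: pb_add; first by rewrite /Tcapacity; poly_bound.
elim: (p * p)%N => [|m IH] /=; last by apply: pb_Tfor => //; poly_bound.
rewrite /Tbody /Tclasses /Tcand /Tdecode /Trsum /Ttest /Tknap.
poly_bound.
Qed.

Theorem theorem6 (R : realType) (p : nat) (hp : (1 <= p)%N) :
  exists (alg : cmd) (q : {poly {poly R}}),
    forall (n w0 : nat) (w : 'I_n -> nat) (eps : R) (x : 'I_n -> R),
      0 < eps < 1 ->
      (forall j, 0 <= x j <= 1) ->
      exists (t : nat) (s : state R),
        [/\ exec alg (input w0 w eps x) t s,
            t%:R <= q.[n%:R, eps^-1]
          & separates p w0 w eps x s].
Proof.
have [q Hq] := Talg_bounded R p.
exists (Seq pows (Seq (scale p) (Seq (capacity p) (nest p (p * p))))), q.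
move=> n w0 w eps x /andP[eps0 _] x01.
set s0 := input w0 w eps x.
(* Entries of [x] are at most 1, so this floor bounds every rounded entry. *)
pose U := Num.trunc ((p * n)%:R / eps).
have Nge : 0 <= (p * n)%:R / eps by rewrite divr_ge0 // ltW.
have /andP[U1 U2] := truncn_itv Nge.
suff [t [s [Hs Ht Hsep]]] : wp (Talg p n U)
    (Seq pows (Seq (scale p) (Seq (capacity p) (nest p (p * p))))) s0
    (separates p w0 w eps x).
  exists t, s; split=> //; apply: (@le_trans _ _ (Talg p n U)%:R); first by rewrite ler_nat.
  by apply: Hq => //; rewrite invr_ge0 ltW.
have E0 : env w0 w eps x s0 by [].
apply: wp_seq; apply: wp_mono (powsP (env_n E0)) (leqnn _) _ => s1 S1 E18.
have E1 : env w0 w eps x s1 by apply: env_same S1 E0.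
have Ex j (jn : (j < n)%N) : rmem s1 1 j.+1 = x (Ordinal jn).
  by rewrite -(env_x (Ordinal jn) E1).
apply: wp_seq; eapply wp_mono; first apply: (@scaleP R p n U s1 eps) => //.
- exact: env_n E1.
- by case: E1 => _ _ -> _.
- by move=> j jn; rewrite (Ex j jn).
- by rewrite -ltr_pdivrMr.
- exact: leqnn.
move=> s2 S2 I2; have E2 : env w0 w eps x s2 by apply: env_same S2 E1.
apply: wp_seq; apply: wp_mono (capacityP p (env_n E2)) (leqnn _) _ => s3 S3 I3.
have P3 : prep w0 w eps x (imem s2 8) (\sum_(j < n) p * imem s2 8 j)%N s3.
  split=> //; first exact: env_same S3 E2.
    by move=> j jn; rewrite S3.1 // S2.1 // E18.
  by move=> j jn; rewrite S3.1.
have Ss3 : sound p w0 w x s3 by left; rewrite /verdict S3.1 // S2.1 // S1.1.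
have Vm : (\sum_(j < n) p * imem s2 8 j <= n * (p * U))%N.
  rewrite -[n in leqRHS]card_ord -sum_nat_const; apply: leq_sum => j _.
  by have [H _] := I2 j (ltn_ord j); rewrite leq_mul2l H orbT.
apply: wp_mono (nestP (p * p) P3 Ss3 hp erefl Vm) (leqnn _) _ => s _ [[Hs _] _ H].
case: (Hs) => [V0|]; [right; split=> //|by left].
apply: (@separation_complete R n p w0 w eps x (fun j => imem s0 1 j.+1) (imem s2 8)) => //.
- by move=> j; rewrite (env_w _ E0).
(* There is no item [n], so its cell holds the default weight 0. *)
- by rewrite /= insubF ?ltnn.
- by move=> j; have [_] := I2 j (ltn_ord j); rewrite (env_x _ E1).
(* From [p * p] on, the guess array still has its initial zeros, in agreement with [g]. *)
move=> g gn g0; apply: H => // i pi; rewrite g0 // S3.1 // S2.1 // S1.1 //.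
Qed.
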